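(* On the Pascal graph, for any ergodic probability measure on the path space under which the vertex process $(V_n)_{n\le0}$ is a Markov process, the filtration $\mathcal{F}$ generated by $(V_n)_{n\le0}$ admits a generating parameterization; hence it is standard.
   Context: The Pascal graph has, at each level $n\le0$, vertices labelled $0,\dots,|n|$; vertex $v$ at level $n$ is joined by one edge to each of the vertices $v$ and $v+1$ at level $n-1$. $V_n$ is the vertex at level $n$ of the random path. A probability measure on the path space is ergodic if the natural filtration of the random path (here equal to $\mathcal F_n=\sigma(V_m;m\le n)$) has trivial tail $\sigma$-field $\bigcap_n\mathcal F_n$. A parameterization of $\mathcal{F}$ is a sequence $(U_n)$ with $U_n$ independent of $\mathcal{F}_{n-1}\vee\sigma(U_m;m\le n-1)$ and $\mathcal{F}_n\subset\mathcal{F}_{n-1}\vee\sigma(U_n)$; it is generating if $\mathcal{F}_n\subset\sigma(U_m;m\le n)$ for all $n$ (''admits'' is understood up to isomorphism, i.e. for a copy of the process). Standard: up to isomorphism, immersed in a filtration generated by independent random variables. *)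

(* Defs.v *)
From HB Require Import structures.
From mathcomp Require Import all_boot all_order all_algebra.
From mathcomp Require Import all_classical all_reals all_analysis.
Set Implicit Arguments. Unset Strict Implicit. Unset Printing Implicit Defensive.
Import Order.TTheory GRing.Theory Num.Theory.
Local Open Scope classical_set_scope.
Local Open Scope ring_scope.

(* Time convention: the paper's level n <= 0 is encoded by k = -n : nat.
   So V k is the vertex at level -k, the "past" of level -k is
   {levels m <= -k} = {indices j >= k}, and level n-1 is index k.+1. *)

(** Pascal graph: a path visits at level -k a vertex in {0..k}; vertex v at
    level n is joined to v and v+1 at level n-1.  A (bi-infinite-to-the-past)
    path is thus v : nat -> nat with v 0 = 0 and v (k+1) - v k in {0,1}. *)
Definition pascal_path (v : nat -> nat) : Prop :=
  v 0%N = 0%N /\ forall k, v k.+1 = v k \/ v k.+1 = (v k).+1.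

Definition sigma_nat (T : Type) (I : set nat) (X : nat -> T -> nat)
  : set (set T) :=
  <<s [set A | exists i j, I i /\ A = X i @^-1` [set j]] >>.

Definition sigma_real (R : realType) (T : Type) (I : set nat)
  (X : nat -> T -> R) : set (set T) :=
  <<s [set A | exists i (B : set R), I i /\ measurable B /\ A = X i @^-1` B] >>.

Definition sigma_join (T : Type) (F G : set (set T)) : set (set T) :=
  <<s F `|` G >>.

Definition natfil (T : Type) (V : nat -> T -> nat) (k : nat) : set (set T) :=
  sigma_nat [set j | (k <= j)%N] V.

Definition pascal_process d (T : measurableType d)
  (V : nat -> T -> nat) : Prop :=
  (forall k j, measurable (V k @^-1` [set j])) /\
  (forall w, pascal_path (fun k => V k w)).

(** ergodic: the tail sigma-field  \bigcap_n F_n  is P-trivial *)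
Definition tail_trivial d (R : realType) (T : measurableType d)
  (P : probability T R) (V : nat -> T -> nat) : Prop :=
  forall A, (forall k, natfil V k A) -> P A = 0%E \/ P A = 1%E.

(** Markov property (discrete state space) in the increasing time direction
    n = -k: given V_{n-1}, V_n is conditionally independent of F_{n-2}. *)
Definition markov_process d (R : realType) (T : measurableType d)
  (P : probability T R) (V : nat -> T -> nat) : Prop :=
  forall k a b A, natfil V k.+2 A ->
    (P (V k @^-1` [set a] `&` V k.+1 @^-1` [set b] `&` A)
       * P (V k.+1 @^-1` [set b]) =
     P (V k @^-1` [set a] `&` V k.+1 @^-1` [set b])
       * P (V k.+1 @^-1` [set b] `&` A))%E.

Definition same_law d d' (R : realType) (T : measurableType d)
  (T' : measurableType d') (P : probability T R) (P' : probability T' R)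
  (V : nat -> T -> nat) (V' : nat -> T' -> nat) : Prop :=
  forall (n : nat) (a : nat -> nat),
    P [set w | forall k, (k < n)%N -> V k w = a k] =
    P' [set w | forall k, (k < n)%N -> V' k w = a k].

Definition indep_sys d (R : realType) (T : measurableType d)
  (P : probability T R) (F G : set (set T)) : Prop :=
  forall A B, F A -> G B -> P (A `&` B) = (P A * P B)%E.

Definition generating_parameterization d (R : realType) (T : measurableType d)
  (P : probability T R) (V : nat -> T -> nat) (U : nat -> T -> R) : Prop :=
  (forall k, measurable_fun setT (U k)) /\
  (forall k, indep_sys P (sigma_real [set k] U)
       (sigma_join (natfil V k.+1) (sigma_real [set j | (k.+1 <= j)%N] U))) /\
  (forall k, natfil V k `<=` sigma_join (natfil V k.+1) (sigma_real [set k] U)) /\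
  (forall k, natfil V k `<=` sigma_real [set j | (k <= j)%N] U).

Definition admits_generating_parameterization d (R : realType)
  (T : measurableType d) (P : probability T R) (V : nat -> T -> nat) : Prop :=
  exists (d' : measure_display) (T' : measurableType d')
         (P' : probability T' R) (V' : nat -> T' -> nat) (U : nat -> T' -> R),
    (forall k j, measurable (V' k @^-1` [set j])) /\
    same_law P P' V V' /\ generating_parameterization P' V' U.

Definition mutually_independent d (R : realType) (T : measurableType d)
  (P : probability T R) (W : nat -> T -> R) : Prop :=
  (forall k, measurable_fun setT (W k)) /\
  forall (s : seq nat) (B : nat -> set R), uniq s ->
    (forall i, measurable (B i)) ->
    P (\big[setI/setT]_(i <- s) (W i @^-1` B i)) =
    (\prod_(i <- s) P (W i @^-1` B i))%E.

(** immersion of filtrations indexed by levels n = -k <= 0 (terminal sigma-field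
    at k = 0): F is included in G and, for every A in F_0 and every level,
    P(A | G_n) admits an F_n-measurable version (equivalently, every
    F-martingale is a G-martingale). *)
Definition immersed d (R : realType) (T : measurableType d)
  (P : probability T R) (F G : nat -> set (set T)) : Prop :=
  (forall k, F k `<=` G k) /\
  forall k A, F 0%N A ->
    exists f : T -> R,
      (forall B : set R, measurable B -> F k (f @^-1` B)) /\
      P.-integrable setT (EFin \o f) /\
      forall B, G k B -> (\int[P]_(x in B) (f x)%:E = P (A `&` B))%E.

Definition standard_filtration d (R : realType) (T : measurableType d)
  (P : probability T R) (V : nat -> T -> nat) : Prop :=
  exists (d' : measure_display) (T' : measurableType d')
         (P' : probability T' R) (V' : nat -> T' -> nat) (W : nat -> T' -> R),
    (forall k j, measurable (V' k @^-1` [set j])) /\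
    same_law P P' V V' /\ mutually_independent P' W /\
    immersed P' (natfil V') (fun k => sigma_real [set j | (k <= j)%N] W).

(* Main.v *)
Require Import Defs.
From HB Require Import structures.
From mathcomp Require Import all_boot all_order all_algebra.
From mathcomp Require Import all_classical all_reals all_analysis.
From mathcomp Require Import measurable_realfun ring lra zify.
Set Implicit Arguments. Unset Strict Implicit. Unset Printing Implicit Defensive.
Import Order.TTheory GRing.Theory Num.Theory.
Local Open Scope classical_set_scope.
Local Open Scope ring_scope.

(* Seen from level -(k+1), the chain moves from vertex v to v or v - 1, so any two copies
   driven by the same randomness keep their order.  Hence, for starting points x <= y, the
   probability that the coupled copies differ at level -k is at most the difference of the
   conditional expectations of V_k given x and given y.  A maximal inequality and the
   triviality of the tail show that E(V_k | V_m) tends to E(V_k) in L^1; so a copy started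
   from a well chosen deterministic vertex of a remote level has nearly the law of V_k and
   nearly coincides with the copies started further back.

   Independent digits are read off one uniform variable.  The copies started at levels
   m_i -> oo are functions of the digits, and their limsup (in i) obeys the transition
   recursion everywhere, because monotone maps commute with limsup on bounded integer
   sequences; Borel-Cantelli estimates identify its law.  Immersion follows since, between
   two levels, the digits take finitely many relevant values. *)

(** * Sigma-algebras *)

Lemma sigma_setC (T : Type) (F : set (set T)) (A : set T) :
  sigma_algebra setT F -> F A -> F (~` A).
Proof. by case=> _ FC _ /FC; rewrite setTD. Qed.

Lemma sigma_setT (T : Type) (F : set (set T)) : sigma_algebra setT F -> F setT.
Proof. by move=> sF; rewrite -setC0; apply: sigma_setC => //; case: sF. Qed.

Lemma sigma_bigcup (T : Type) (F : set (set T)) (D : set nat) (A : nat -> set T) :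
  sigma_algebra setT F -> (forall n, D n -> F (A n)) -> F (\bigcup_(n in D) A n).
Proof.
case=> F0 _ FU FA; rewrite bigcup_mkcond; apply: FU => n.
by case: ifPn => // /set_mem; apply: FA.
Qed.

Lemma sigma_bigcap (T : Type) (F : set (set T)) (D : set nat) (A : nat -> set T) :
  sigma_algebra setT F -> (forall n, D n -> F (A n)) -> F (\bigcap_(n in D) A n).
Proof.
move=> sF FA; rewrite -[X in F X]setCK setC_bigcap; apply: sigma_setC => //.
by apply: sigma_bigcup => // n Dn; apply: sigma_setC => //; apply: FA.
Qed.

Lemma sigma_setU (T : Type) (F : set (set T)) (A B : set T) :
  sigma_algebra setT F -> F A -> F B -> F (A `|` B).
Proof.
move=> sF FA FB; rewrite -bigcup2inE; apply: sigma_bigcup => // -[|[|n]] //=.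
Qed.

Lemma sigma_setI (T : Type) (F : set (set T)) (A B : set T) :
  sigma_algebra setT F -> F A -> F B -> F (A `&` B).
Proof.
move=> sF FA FB; rewrite -[A `&` B]setCK setCI; apply: (sigma_setC sF).
by apply: sigma_setU => //; apply: sigma_setC.
Qed.

Lemma sigma_preimage (T : Type) (X : countType) (F : set (set T)) (Z : T -> X) :
  sigma_algebra setT F -> (forall x, F (Z @^-1` [set x])) ->
  forall S, F (Z @^-1` S).
Proof.
move=> sF FZ S.
have -> : Z @^-1` S = \bigcup_(n in [set n | exists2 x, S x & pickle x = n])
    (if unpickle n is Some x then Z @^-1` [set x] else set0).
  apply/seteqP; split=> w /=.
    by move=> SZ; exists (pickle (Z w)); [exists (Z w)|rewrite pickleK].
  by case=> n [x Sx <-]; rewrite pickleK /= => ->.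
apply: sigma_bigcup => // n [x Sx <-]; rewrite pickleK; exact: FZ.
Qed.

Lemma smallest_sigma_sub (T : Type) (G F : set (set T)) :
  sigma_algebra setT F -> G `<=` F -> <<s G >> `<=` F.
Proof. by move=> sF GF; apply: smallest_sub. Qed.

(** The sets that agree on [E] with a member of [H] form a sigma-algebra, so generators suffice.
    This reduces events to a smaller sigma-field on the atoms of a discrete variable. *)
Lemma sigma_trace (T : Type) (G H : set (set T)) (E : set T) :
  sigma_algebra setT H ->
  (forall A, G A -> exists2 A', H A' & A `&` E = A' `&` E) ->
  forall A, <<s G >> A -> exists2 A', H A' & A `&` E = A' `&` E.
Proof.
move=> sH GH; apply: smallest_sigma_sub => //; split.
- by exists set0 => //; case: sH.
- move=> A [A' HA' AE]; exists (~` A'); first exact: sigma_setC.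
  rewrite setTD; apply/seteqP; split=> w [nA Ew]; split=> // A'w; apply: nA.
    by have []: (A `&` E) w by rewrite AE.
  by have []: (A' `&` E) w by rewrite -AE.
- move=> A AE.
  have /boolp.choice[A' A'P] n : exists B, H B /\ A n `&` E = B `&` E.
    by have [B] := AE n; exists B.
  have HA' n : H (A' n) by case: (A'P n).
  exists (\bigcup_n A' n); first exact: sigma_bigcup.
  rewrite !setI_bigcupl; apply: eq_bigcupr => n _.
  by case: (A'P n).
Qed.

(** * Probabilities as real numbers *)

Definition pr d (R : realType) (T : measurableType d) (P : probability T R)
  (A : set T) : R := fine (P A).

Section basics.
Context d (R : realType) (T : measurableType d) (P : probability T R).
Implicit Types A B C : set T.

Lemma prE A : measurable A -> P A = (pr P A)%:E.
Proof. by move=> mA; rewrite /pr fineK// fin_num_measure. Qed.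

Lemma pr_ge0 A : 0 <= pr P A.
Proof. exact: fine_ge0. Qed.

Lemma prT : pr P setT = 1.
Proof. by rewrite /pr probability_setT. Qed.

Lemma pr0 : pr P set0 = 0.
Proof. by rewrite /pr measure0. Qed.

Lemma le_pr A B : measurable A -> measurable B -> A `<=` B -> pr P A <= pr P B.
Proof.
by move=> mA mB AB; rewrite -lee_fin -!prE//; apply: le_measure; rewrite ?inE.
Qed.

Lemma pr_le1 A : measurable A -> pr P A <= 1.
Proof. by move=> mA; rewrite -prT; apply: le_pr. Qed.

Lemma prU A B : measurable A -> measurable B -> A `&` B = set0 ->
  pr P (A `|` B) = pr P A + pr P B.
Proof.
move=> mA mB AB; apply: EFin_inj; rewrite EFinD -!prE//; last exact: measurableU.
by rewrite measureU.
Qed.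

Lemma pr_leU A B : measurable A -> measurable B ->
  pr P (A `|` B) <= pr P A + pr P B.
Proof.
move=> mA mB; rewrite -lee_fin EFinD -!prE//; last exact: measurableU.
exact: measureU2.
Qed.

Lemma prIC A B : measurable A -> measurable B ->
  pr P B = pr P (A `&` B) + pr P (~` A `&` B).
Proof.
move=> mA mB; rewrite -prU; last 3 first.
- exact: measurableI.
- by apply: measurableI => //; apply: measurableC.
- by rewrite setIACA setICr set0I.
by rewrite -setIUl setUCr setTI.
Qed.

Lemma pr_bigcup_le (F : nat -> set T) x : (forall i, measurable (F i)) ->
  (forall N, pr P (\bigcup_(i in `I_N) F i) <= x) -> pr P (\bigcup_i F i) <= x.
Proof.
move=> mF Fx; pose B N := \bigcup_(i in `I_N) F i.
have mB N : measurable (B N) by apply: bigcup_measurable.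
have mU : measurable (\bigcup_i F i) by apply: bigcup_measurable.
have BU : \bigcup_N B N = \bigcup_i F i.
  apply/seteqP; split=> w [n _]; first by move=> [l _ ?]; exists l.
  by move=> ?; exists n.+1 => //; exists n => /=.
have cvB : (P \o B @ \oo --> P (\bigcup_N B N))%E.
  apply: nondecreasing_cvg_mu => //; first by rewrite BU.
  by move=> i j ij; apply/subsetPset; apply: bigcup_subset => l /= /leq_trans; apply.
rewrite -lee_fin -prE// -BU -(cvg_lim _ cvB)//.
apply: lime_le; first by apply/cvg_ex; eexists; exact: cvB.
by apply: nearW => N /=; rewrite prE// lee_fin Fx.
Qed.

Lemma prM_indep A B : measurable A -> measurable B ->
  pr P (A `&` B) = pr P A * pr P B -> P (A `&` B) = (P A * P B)%E.
Proof.
by move=> mA mB; rewrite !prE//; [move->|apply: measurableI].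
Qed.

Lemma pr_partition n (Z : T -> nat) C :
  (forall w, (Z w < n)%N) -> (forall j, measurable (Z @^-1` [set j])) ->
  measurable C ->
  \sum_(j < n) pr P (Z @^-1` [set j : nat] `&` C) = pr P C.
Proof.
move=> Zn mZ mC.
suff H m : \sum_(j < m) pr P (Z @^-1` [set j : nat] `&` C) =
    pr P ([set w | (Z w < m)%N] `&` C).
  rewrite H; congr pr; apply/seteqP; split=> w; first by case.
  by move=> Cw; split=> //=; apply: Zn.
have mlt k : measurable [set w | (Z w < k)%N].
  exact: (sigma_preimage (@sigma_algebra_measurable _ T) mZ [set j | (j < k)%N]).
elim: m => [|m IH].
  by rewrite big_ord0 (_ : _ `&` _ = set0) ?pr0//; apply/seteqP; split=> w // [].
rewrite big_ord_recr/= IH -prU; last 3 first.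
- exact: measurableI.
- exact: measurableI.
- by apply/seteqP; split=> w //= [[+ _] [Zm _]]; rewrite Zm ltnn.
congr pr; apply/seteqP; split=> w /=.
  by move=> [[? ?]|[-> ?]]; split=> //; lia.
move=> [Zm Cw]; have [?|?] := ltnP (Z w) m; [left|right] => //; split => //; lia.
Qed.

(* Weighted sums over the values of [Z] stand for expectations restricted to [C]. *)
Definition wsum n (f : nat -> R) (Z : T -> nat) C : R :=
  \sum_(j < n) f j * pr P (Z @^-1` [set j : nat] `&` C).

Lemma wsum_split n f Z A C : (forall j, measurable (Z @^-1` [set j])) ->
  measurable A -> measurable C ->
  wsum n f Z C = wsum n f Z (A `&` C) + wsum n f Z (~` A `&` C).
Proof.
move=> mZ mA mC; rewrite /wsum -big_split/=; apply: eq_bigr => j _.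
rewrite -mulrDr; congr (_ * _); rewrite (prIC mA); last exact: measurableI.
by rewrite setICA [in X in _ + X]setICA.
Qed.

Lemma wsum_ge0 n f Z C : (forall j, 0 <= f j) -> 0 <= wsum n f Z C.
Proof. by move=> f0; apply: sumr_ge0 => j _; rewrite mulr_ge0// pr_ge0. Qed.

Lemma wsum_le n f g Z C : (forall j, (j < n)%N -> f j <= g j) ->
  wsum n f Z C <= wsum n g Z C.
Proof. by move=> fg; apply: ler_sum => j _; rewrite ler_wpM2r ?pr_ge0 ?fg. Qed.

Lemma wsum_indic n a Z C : (a < n)%N ->
  wsum n (fun j => (j == a)%:R) Z C = pr P (Z @^-1` [set a] `&` C).
Proof.
move=> an; rewrite /wsum (bigD1 (Ordinal an))//= eqxx mul1r big1 ?addr0//.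
by move=> j; rewrite -val_eqE/= => /negPf->; rewrite mul0r.
Qed.

Lemma wsum_cst n c Z C :
  (forall w, (Z w < n)%N) -> (forall j, measurable (Z @^-1` [set j])) ->
  measurable C -> wsum n (fun=> c) Z C = c * pr P C.
Proof. by move=> Zn mZ mC; rewrite /wsum -mulr_sumr pr_partition. Qed.

Lemma wsumD n f g Z C : wsum n (fun j => f j + g j) Z C = wsum n f Z C + wsum n g Z C.
Proof. by rewrite /wsum -big_split; apply: eq_bigr => j _; rewrite mulrDl. Qed.

Lemma wsumZ n c f Z C : wsum n (fun j => c * f j) Z C = c * wsum n f Z C.
Proof. by rewrite /wsum mulr_sumr; apply: eq_bigr => j _; rewrite mulrA. Qed.

End basics.

(** * Filtration of a sequence *)

Lemma natfil_sigma (T : Type) (V : nat -> T -> nat) k :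
  sigma_algebra setT (natfil V k).
Proof. exact: smallest_sigma_algebra. Qed.

Lemma natfil_preimage (T : Type) (V : nat -> T -> nat) k j S :
  (k <= j)%N -> natfil V k (V j @^-1` S).
Proof.
move=> kj; apply: sigma_preimage; first exact: natfil_sigma.
by move=> i; apply: sub_sigma_algebra; exists j, i.
Qed.

Lemma natfil_le (T : Type) (V : nat -> T -> nat) k j :
  (k <= j)%N -> natfil V j `<=` natfil V k.
Proof.
move=> kj; apply: sub_sigma_algebra2 => A [i [a [/= ji ->]]].
by exists i, a; split => //=; apply: leq_trans ji.
Qed.

Lemma natfil_measurable d (T : measurableType d) (V : nat -> T -> nat) k :
  (forall k j, measurable (V k @^-1` [set j])) ->
  forall A, natfil V k A -> measurable A.
Proof.
move=> mV; apply: smallest_sigma_sub; first exact: sigma_algebra_measurable.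
by move=> _ [i [a [_ ->]]].
Qed.

(** * Convergence of conditional expectations to constants *)

(** Markov property in product form, which leaves [kern] free at vertices of probability zero. The
    event [C] may involve [V k.+1] itself. *)
Definition chain d (R : realType) (T : measurableType d) (P : probability T R)
  (V : nat -> T -> nat) (kern : nat -> nat -> nat -> R) : Prop :=
  forall k C a b, natfil V k.+1 C ->
    pr P (V k @^-1` [set a] `&` (V k.+1 @^-1` [set b] `&` C)) =
    kern k b a * pr P (V k.+1 @^-1` [set b] `&` C).

Definition bstep (R : realType) (kern : nat -> nat -> nat -> R) k
  (f : nat -> R) : nat -> R := fun b => \sum_(a < k.+1) kern k b a * f a.

(* [bop kern k n f b] is the conditional expectation of [f (V k)] given [V (k + n) = b]. *)
Fixpoint bop (R : realType) (kern : nat -> nat -> nat -> R) k n (f : nat -> R)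
  : nat -> R :=
  if n is n'.+1 then bop kern k.+1 n' (bstep kern k f) else f.

(** One step of the tower property, for arbitrary [Z] and [Z'] so as to serve both the chain and its
    coupled copies. *)
Lemma wsum_step d (R : realType) (T : measurableType d) (P : probability T R)
  n n' (K : nat -> nat -> R) f (Z Z' : T -> nat) (C : set T) :
  (forall w, (Z' w < n')%N) -> (forall j, measurable (Z @^-1` [set j])) ->
  (forall j, measurable (Z' @^-1` [set j])) -> measurable C ->
  (forall a b, pr P (Z @^-1` [set a] `&` (Z' @^-1` [set b] `&` C)) =
    K b a * pr P (Z' @^-1` [set b] `&` C)) ->
  wsum P n f Z C = wsum P n' (fun b => \sum_(a < n) K b a * f a) Z' C.
Proof.
move=> Zn mZ mZ' mC H; rewrite /wsum.
under [RHS]eq_bigr do rewrite mulr_suml.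
rewrite exchange_big/=; apply: eq_bigr => a _.
rewrite -(pr_partition P Zn mZ'); last exact: measurableI.
rewrite mulr_sumr; apply: eq_bigr => b _.
by rewrite setICA H; ring.
Qed.

Section one_chain.
Context d (R : realType) (T : measurableType d) (P : probability T R).
Variables (V : nat -> T -> nat) (kern : nat -> nat -> nat -> R).
Hypothesis mV : forall k j, measurable (V k @^-1` [set j]).
Hypothesis Vk : forall k w, (V k w < k.+1)%N.
Hypothesis cV : chain P V kern.

Lemma wsum_bop n k f C : natfil V (k + n) C ->
  wsum P k.+1 f (V k) C = wsum P (k + n).+1 (bop kern k n f) (V (k + n)%N) C.
Proof.
elim: n k f => [|n IH] k f FC /=; first by rewrite addn0.
have mC : measurable C := natfil_measurable mV FC.
rewrite (wsum_step _ f (Vk k.+1) (mV k) (mV k.+1) mC (K := kern k)).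
  by rewrite -addSnnS; apply: IH; rewrite addSnnS.
by move=> a b; apply: cV; apply: natfil_le FC; lia.
Qed.

Variables (k : nat) (f : nat -> R).
Hypothesis f0 : forall j, 0 <= f j.

Let c := wsum P k.+1 f (V k) setT.
Let M n w := bop kern k n f (V (k + n)%N w).
Let F r n := [set w | r < M n w].

Let F_fil r n : natfil V (k + n) (F r n).
Proof. exact: (natfil_preimage [set j | r < bop kern k n f j]). Qed.

Let F_meas r n : measurable (F r n).
Proof. exact: (natfil_measurable mV (@F_fil r n)). Qed.

(** [F r n] is determined by [V (k + n)]: a value of [V (k + n)] either has conditional expectation
    above [r] or does not meet the event. *)
Lemma wsum_bop_gt r n C : natfil V (k + n) C ->
  r * pr P (F r n `&` C) <= wsum P k.+1 f (V k) (F r n `&` C).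
Proof.
move=> FC; have FFC : natfil V (k + n) (F r n `&` C).
  exact: (sigma_setI (@natfil_sigma _ _ _) (@F_fil r n) FC).
have mFC : measurable (F r n `&` C) by exact: (natfil_measurable mV FFC).
rewrite (wsum_bop f FFC) -(wsum_cst P r (Vk (k + n)) (mV (k + n)) mFC).
apply: ler_sum => j _.
have [rj|jr] := ltP r (bop kern k n f j); first by rewrite ler_wpM2r ?pr_ge0 ?ltW.
rewrite (_ : _ `&` _ = set0) ?pr0 ?mulr0//; apply/seteqP; split=> w //= [Vj [+ _]].
by rewrite /F/= /M Vj ltNge jr.
Qed.

(* A maximal inequality: decompose according to the most remote level at which
   the conditional expectation exceeds [r]. *)
Lemma maximal_ineq r m N C : natfil V (k + (m + N)) C ->
  r * pr P (\big[setU/set0]_(l < N) F r (m + l)%N `&` C) <=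
  wsum P k.+1 f (V k) (\big[setU/set0]_(l < N) F r (m + l)%N `&` C).
Proof.
elim: N C => [|N IH] C FC.
  by rewrite big_ord0 set0I pr0 mulr0 wsum_ge0.
have {}FC : natfil V (k + (m + N)) C by apply: natfil_le FC; lia.
have mC : measurable C. exact: (natfil_measurable mV FC).
rewrite big_ord_recr/=; set B := \big[setU/set0]_(l < N) _.
have mB : measurable B by apply: bigsetU_measurable.
have mBFC : measurable ((B `|` F r (m + N)%N) `&` C).
  by apply: measurableI => //; apply: measurableU.
rewrite (prIC P (@F_meas r (m + N)%N) mBFC) (wsum_split P _ f (mV k) (@F_meas r (m + N)%N) mBFC).
have -> : F r (m + N)%N `&` ((B `|` F r (m + N)%N) `&` C) = F r (m + N)%N `&` C.
  by apply/seteqP; split=> w /=; tauto.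
have -> : ~` F r (m + N)%N `&` ((B `|` F r (m + N)%N) `&` C) =
    B `&` (~` F r (m + N)%N `&` C).
  by apply/seteqP; split=> w /=; tauto.
(* [F r (m + N)] lies in the past of all other events of the union, so its complement can be
   absorbed into [C]. *)
rewrite mulrDr lerD ?wsum_bop_gt//; apply: IH.
have sF := @natfil_sigma _ V (k + (m + N)).
exact: (sigma_setI sF (sigma_setC sF (@F_fil r (m + N)%N)) FC).
Qed.

Lemma maximal_ineq_bigcup r m : 0 <= r ->
  r * pr P (\bigcup_l F r (m + l)%N) <= c.
Proof.
rewrite le_eqVlt => /predU1P[<-|r0]; first by rewrite mul0r wsum_ge0.
suff : pr P (\bigcup_l F r (m + l)%N) <= c / r by rewrite ler_pdivlMr// mulrC.
apply: pr_bigcup_le => // N; rewrite (bigcup_mkord N (fun l => F r (m + l)%N)).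
set B := \big[setU/set0]_(l < N) _.
have mB : measurable B by apply: bigsetU_measurable.
rewrite ler_pdivlMr// mulrC.
have := @maximal_ineq r m N setT (sigma_setT (@natfil_sigma _ _ _)).
rewrite setIT => /le_trans; apply; rewrite /c.
rewrite (wsum_split P _ f (mV k) mB measurableT) setIT lerDl; exact: wsum_ge0.
Qed.

Hypothesis tV : tail_trivial P V.

(** The upper limit of the events [F r n] is a tail event. Probability one would contradict the
    maximal inequality, since [c < r]; so it is null, and the unions of remote [F r n] have
    probability tending to zero. *)
Lemma bop_gt_cvg0 r e : c < r -> 0 < e ->
  exists n0, forall n, (n0 <= n)%N -> pr P (F r n) <= e.
Proof.
move=> cr e0.
have c0 : 0 <= c by apply: wsum_ge0.
have r0 : 0 < r by apply: le_lt_trans cr.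
have mL : measurable (lim_sup_set (F r)).
  by apply: bigcapT_measurable => n; apply: bigcup_measurable.
have tL j : natfil V j (lim_sup_set (F r)).
  have -> : lim_sup_set (F r) =
      \bigcap_(n in [set n | (j <= n)%N]) \bigcup_(l >= n) F r l.
    apply/seteqP; split=> w Lw n; first by move=> _; apply: Lw.
    move=> _; have [l /= jl Fl] := Lw (maxn j n) (leq_maxl _ _).
    by exists l => //=; apply: leq_trans jl; apply: leq_maxr.
  apply: (sigma_bigcap (@natfil_sigma _ V j)) => n /= jn.
  apply: (sigma_bigcup (@natfil_sigma _ V j)).
  by move=> l /= nl; apply: natfil_le (@F_fil r l); lia.
have L0 : P (lim_sup_set (F r)) = 0%E.
  have [//|L1] := tV tL.
  have := maximal_ineq_bigcup 0 (ltW r0).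
  suff -> : pr P (\bigcup_l F r (0 + l)%N) = 1 by rewrite mulr1 leNgt cr.
  apply/le_anti; rewrite pr_le1/=; last exact: bigcup_measurable.
  have <- : pr P (lim_sup_set (F r)) = 1 by rewrite /pr L1.
  apply: le_pr => //; first exact: bigcup_measurable.
  by move=> w /(_ 0%N Logic.I)[l _ ?]; exists l.
have : (P (\bigcup_(l >= n) F r l) @[n --> \oo] --> 0%E)%E.
  rewrite -L0; apply: lim_sup_set_cvg; first by move=> l; apply: F_meas.
  rewrite (le_lt_trans (probability_le1 _ _)) ?ltry//.
  by apply: bigcup_measurable => *; apply: F_meas.
move=> /fine_cvgP[_].
move=> /cvgrPdist_le/(_ e e0)[n0 _ Hn0]; exists n0 => n /Hn0/=.
rewrite sub0r normrN ger0_norm ?fine_ge0//; apply: le_trans.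
apply: le_pr => //; first by apply: bigcup_measurable => *; apply: F_meas.
by move=> w Fw; exists n => /=.
Qed.

(** Since [Mn] has mean [c], the identity [|x| = 2 x^+ - x] leaves only upward deviations to
    control. On [F r n] the integral of [Mn] is that of the bounded variable [f (V k)], hence small
    with the probability of [F r n]. *)
Lemma bop_cvg_L1 e : 0 < e -> exists n0, forall n, (n0 <= n)%N ->
  wsum P (k + n).+1 (fun y => `|bop kern k n f y - c|) (V (k + n)%N) setT <= e.
Proof.
move=> e0; pose K := \sum_(j < k.+1) f j.
have K0 : 0 <= K by apply: sumr_ge0.
have c0 : 0 <= c by apply: wsum_ge0.
pose r := c + e / 4.
have cr : c < r by rewrite /r; lra.
(* Probability of [F r n] below which the integral of [f (V k)] over it is at most [e / 4]; the
   [+ 1] covers [K = 0]. *)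
have d0 : 0 < e / 4 / (K + 1) by apply: divr_gt0; lra.
have [n0 Hn0] := bop_gt_cvg0 cr d0; exists n0 => n /Hn0 Fn.
set Mn := bop kern k n f; set Vn := V (k + n)%N.
have mT := @measurableT _ T.
have FK : wsum P k.+1 f (V k) (F r n) <= e / 4.
  have : wsum P k.+1 f (V k) (F r n) <= K * pr P (F r n).
    rewrite -(wsum_cst P K (Vk k) (mV k) (@F_meas r n)).
    apply: wsum_le => j jk; rewrite /K (bigD1 (Ordinal jk))//= lerDl.
    exact: sumr_ge0.
  move=> /le_trans; apply.
  apply: (@le_trans _ _ ((K + 1) * (e / 4 / (K + 1)))).
    by apply: ler_pM => //; [exact: pr_ge0|lra].
  by rewrite mulrC divfK//; lra.
pose h y : R := Mn y * (r < Mn y)%R%:R.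
have H1 : wsum P (k + n).+1 h Vn setT =
    wsum P k.+1 f (V k) (F r n).
  rewrite (wsum_bop f (@F_fil r n)); apply: eq_bigr => j _; rewrite -/Mn -/Vn /h.
  have [rj|jr] := ltP r (Mn j).
    rewrite mulr1; congr (_ * pr P _); apply/seteqP; split=> w [Vj _] //; split=> //.
    by rewrite /F/= /M -/Vn Vj.
  rewrite mulr0 mul0r (_ : _ `&` _ = set0) ?pr0 ?mulr0//.
  apply/seteqP; split=> w //= [Vj]; rewrite /F/= /M -/Vn Vj -/Mn.
  by rewrite ltNge jr.
have H2 : wsum P (k + n).+1 Mn Vn setT = c.
  by rewrite -(wsum_bop f (sigma_setT (@natfil_sigma _ _ _))).
(* Pointwise form of [|x| = 2 x^+ - x], with slack for the gap between [c] and [r]. It integrates to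
   at most [2 (e / 4) - c + e / 2 + c]. *)
apply: (@le_trans _ _ (wsum P (k + n).+1
   (fun y => (2 * h y + (-1) * Mn y) + (e / 2 + c)) Vn setT)).
  apply: wsum_le => j _; rewrite /h; have [rj|jr] := ltP r (Mn j).
    by rewrite mulr1; rewrite ger0_norm; rewrite /r in rj *; lra.
  by rewrite mulr0 mulr0 ler_norml; apply/andP; split; rewrite /r in jr *; lra.
have cE : wsum P (k + n).+1 (fun=> e / 2 + c) Vn setT = e / 2 + c.
  by rewrite (wsum_cst P _ (Vk (k + n)%N) (mV _) mT) prT mulr1.
rewrite 2!wsumD !wsumZ cE H1 H2; lra.
Qed.

End one_chain.

(** * Choice of a deterministic starting vertex *)

Lemma wsum_exists_le d (R : realType) (T : measurableType d) (P : probability T R)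
  n (g : nat -> R) (Z : T -> nat) e :
  (forall w, (Z w < n)%N) -> (forall j, measurable (Z @^-1` [set j])) ->
  wsum P n g Z setT <= e -> exists2 x, (x < n)%N & g x <= e.
Proof.
move=> Zn mZ ge; apply: contrapT => nex.
have gt x : (x < n)%N -> e < g x.
  by move=> xn; rewrite ltNge; apply/negP => gx; apply: nex; exists x.
have S1 := pr_partition P Zn mZ (@measurableT _ T); rewrite prT in S1.
have : \sum_(j < n) (g j - e) * pr P (Z @^-1` [set j : nat] `&` setT) <= 0.
  under eq_bigr do rewrite mulrBl; rewrite sumrB -mulr_sumr S1.
  by move: ge; rewrite /wsum; lra.
have p0 (j : 'I_n) : true -> 0 <= (g j - e) * pr P (Z @^-1` [set j : nat] `&` setT).
  by move=> _; rewrite mulr_ge0 ?pr_ge0// subr_ge0 ltW// gt.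
move=> s0; have /eqP : \sum_(j < n) (g j - e) * pr P (Z @^-1` [set j : nat] `&` setT) = 0.
  by apply/le_anti; rewrite s0 sumr_ge0.
rewrite psumr_eq0// => /allP H; move: S1; rewrite big1 => [/eqP|j _].
  by rewrite eq_sym oner_eq0.
have := H j; rewrite mem_index_enum mulf_eq0 => /(_ erefl)/=.
by rewrite gt_eqF ?subr_gt0 ?gt//= => /eqP.
Qed.

(** Each [M k (V m)] is close in L^1 to a constant [c k]. Averaged over [x] drawn from the law of
    [V m], the quantity to bound is at most twice that distance, and some [x] does no worse than the
    average. Summing over [k <= K] first makes one [x] serve all these levels. *)
Lemma exists_start d (R : realType) (T : measurableType d) (P : probability T R)
  (V : nat -> T -> nat) (kern : nat -> nat -> nat -> R) (K : nat) (e : R) :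
  (forall k j, measurable (V k @^-1` [set j])) ->
  (forall k w, (V k w < k.+1)%N) -> chain P V kern -> tail_trivial P V ->
  0 < e ->
  exists m x, [/\ (K < m)%N, (x <= m)%N & forall k, (k <= K)%N ->
    let M := bop kern k (m - k) (fun j => j%:R) in
    wsum P m.+1 (fun y => `|M y - M x|) (V m) setT <= e].
Proof.
move=> mV Vk cV tV e0.
(* Two deviations from [c k] for each of the [K + 1] levels. *)
pose e' := e / 2 / K.+1%:R.
have e'0 : 0 < e' by rewrite !divr_gt0.
pose c k := wsum P k.+1 (fun j => j%:R) (V k) setT.
have /boolp.choice[N HN] k : exists n0, forall n, (n0 <= n)%N ->
    wsum P (k + n).+1 (fun y => `|bop kern k n (fun j => j%:R) y - c k|)
      (V (k + n)%N) setT <= e'.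
  by apply: bop_cvg_L1 => // j.
pose m := (K.+1 + \sum_(k < K.+1) N k)%N.
pose M k := bop kern k (m - k) (fun j => j%:R).
have HM k : (k <= K)%N -> wsum P m.+1 (fun y => `|M k y - c k|) (V m) setT <= e'.
  move=> kK; have := HN k (m - k)%N; rewrite subnKC; last by rewrite /m; lia.
  apply; rewrite /m; have : (N k <= \sum_(k < K.+1) N k)%N by
    rewrite (bigD1 (Ordinal (kK : k < K.+1)%N))//= leq_addr.
  lia.
pose g x := \sum_(k < K.+1) wsum P m.+1 (fun y => `|M k y - M k x|) (V m) setT.
have mT := @measurableT _ T.
have gE : wsum P m.+1 g (V m) setT <= e.
  rewrite {1}/wsum; under eq_bigr do rewrite mulr_suml.
  rewrite exchange_big/=.
  apply: (@le_trans _ _ (\sum_(k < K.+1) (2 * e'))); last first.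
    rewrite sumr_const card_ord -mulr_natr /e'.
    rewrite le_eqVlt; apply/orP; left; apply/eqP; field.
    by rewrite nat1r pnatr_eq0.
  apply: ler_sum => k _.
  have kK : (k <= K)%N by rewrite -ltnS.
  have -> : 2 * e' = 1 * e' + e' by ring.
  apply: (@le_trans _ _ (wsum P m.+1 (fun x => 1 * `|M k x - c k| + e') (V m) setT)).
    have := @wsum_le _ _ _ P m.+1
      (fun x => wsum P m.+1 (fun y => `|M k y - M k x|) (V m) setT)
      (fun x => 1 * `|M k x - c k| + e') (V m) setT.
    apply => x _.
    apply: (@le_trans _ _ (wsum P m.+1 (fun y => `|M k y - c k| + `|M k x - c k|) (V m) setT)).
      apply: wsum_le => y _.
      have -> : M k y - M k x = (M k y - c k) - (M k x - c k) by ring.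
      exact: ler_normB.
    by rewrite wsumD (wsum_cst P _ (Vk m) (mV _) mT) prT mulr1 mul1r addrC lerD2l HM.
  by rewrite wsumD wsumZ (wsum_cst P _ (Vk m) (mV _) mT) prT mulr1 lerD2r !mul1r HM.
have [x xm gx] := wsum_exists_le (Vk m) (mV m) gE.
exists m, x; split=> [|//|k kK /=]; first by rewrite /m; lia.
apply: le_trans gx; rewrite /g (bigD1 (Ordinal (kK : k < K.+1)%N))//= lerDl.
by apply: sumr_ge0 => j _; apply: wsum_ge0.
Qed.

(** * Independent digits of a uniform variable *)

Section measure.
Context (R : realType).

Let f (a b : R) : measurableTypeR R -> measurableTypeR R := fun x => a * x + b.

Let mf (a b : R) : measurable_fun setT (f a b).
Proof.
by apply: measurable_funD => //; apply: measurable_funM.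
Qed.

(** By uniqueness of Lebesgue measure it is enough to compare both sides on half-open intervals. *)
Lemma lebesgue_measure_affine (a b : R) (E : set (measurableTypeR R)) :
  0 < a -> measurable E ->
  (@lebesgue_measure R E = a%:E * lebesgue_measure [set x | E (a * x + b)%R])%E.
Proof.
move=> a0 mE.
pose mu := mscale (NngNum (ltW a0)) (pushforward (@lebesgue_measure R) (f a b)).
have -> : (a%:E * lebesgue_measure [set x | E (a * x + b)%R] = mu (mf a b) E)%E by [].
rewrite /mu; apply: lebesgue_measure_unique => //.
move=> _ [[u v] _ <-]/=.
rewrite /mscale/= /pushforward lebesgue_measure_itv/=.
have -> : f a b @^-1` [set` `]u, v]] = [set` `](u - b) / a, (v - b) / a]].
  apply/seteqP; split=> x /=; rewrite !in_itv/= /f ltr_pdivrMr// ler_pdivlMr//.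
    by move=> /andP[? ?]; apply/andP; split; lra.
  by move=> /andP[? ?]; apply/andP; split; lra.
rewrite lebesgue_measure_itv/= !lte_fin ltr_pM2r ?invr_gt0// ltrD2r.
case: ifP => _; last by rewrite mule0.
by rewrite -!EFinB -EFinM; congr EFin; field; rewrite gt_eqF.
Qed.

End measure.

(** The interval is open on the left to match the test [x <= p] of [pstep], which cuts it into []0,
    p]] and []p, 1]]. *)
Definition unif (R : realType) : set (measurableTypeR R) -> \bar R :=
  mrestr (@lebesgue_measure R) (measurable_itv `]0, 1]).

HB.instance Definition _ (R : realType) := Measure.on (@unif R).

Lemma unif_setT (R : realType) : @unif R setT = 1%E.
Proof. by rewrite /unif /mrestr setTI lebesgue_measure_itv/= lte01 oppr0 adde0. Qed.

HB.instance Definition _ (R : realType) :=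
  Measure_isProbability.Build _ _ _ (@unif R) (@unif_setT R).

Section digits.
Context (R : realType).
Let U := measurableTypeR R.
Let punif := pr (@unif R).

(* Reads one Bernoulli digit of parameter [p] off a uniform variable and rescales
   what remains to a uniform variable independent of the digit. *)
Definition pstep (p x : R) : bool * R :=
  if x <= p then (true, p^-1 * x) else (false, (1 - p)^-1 * (x - p)).

Fixpoint digits (ps : seq R) (x : R) : seq bool * R :=
  if ps is p :: ps' then
    let s := pstep p x in let r := digits ps' s.2 in (s.1 :: r.1, r.2)
  else ([::], x).

Lemma measurable_affine (a b : R) (E : set U) : measurable E ->
  measurable ([set x | E (a * x + b)] : set U).
Proof.
move=> mE; rewrite -[X in measurable X]setTI.
have : measurable_fun setT (fun x : U => a * x + b : U).
  by apply: measurable_funD => //; apply: measurable_funM.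
exact.
Qed.

(** The last hypothesis puts the affine preimage of []0, 1]] inside []0, 1]], so the restriction in
    [unif] cuts nothing off. *)
Lemma unif_affine (a b : R) (E : set U) : 0 < a -> measurable E ->
  (forall x, 0 < a * x + b <= 1 -> 0 < x <= 1) ->
  punif [set x | E (a * x + b) /\ 0 < a * x + b <= 1] = a^-1 * punif E.
Proof.
move=> a0 mE H; pose I : set U := [set` `]0, 1]].
have mI : measurable I by exact: measurable_itv.
have mEI : measurable (E `&` I) by exact: measurableI.
have mA := measurable_affine a b mEI.
have EA : [set x | (E `&` I) (a * x + b)] `&` I = [set x | (E `&` I) (a * x + b)].
  apply/seteqP; split=> x /= [] //; rewrite /I/= !in_itv/= => Ex Ix; split=> //.
  by apply: H.
have -> : [set x | E (a * x + b) /\ 0 < a * x + b <= 1] =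
    [set x | (E `&` I) (a * x + b)] :> set U.
  by apply/seteqP; split=> x /=; rewrite /I/= !in_itv/=.
have punifE B : punif B = fine (lebesgue_measure (B `&` I)) by [].
have fin := fin_num_measure (@unif R) _ mA.
rewrite !punifE EA (lebesgue_measure_affine b a0 mEI) fineM//.
  by rewrite mulKf// gt_eqF.
by rewrite -EA.
Qed.

(** Each branch is an affine bijection of its subinterval, of length [p] or [1 - p], onto []0, 1]].
    Allowing different events on the two branches yields both the law of the digit and its
    independence from the remainder. *)
Lemma unif_pstep (p : R) (E0 E1 : set U) : 0 <= p <= 1 ->
  measurable E0 -> measurable E1 ->
  let A : set U := [set x | if (pstep p x).1 then E1 (pstep p x).2 else E0 (pstep p x).2] in
  measurable A /\ punif A = p * punif E1 + (1 - p) * punif E0.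
Proof.
move=> /andP[p0 p1] m0 m1 A.
pose A1 : set U := [set` `]-oo, p]] `&` [set x | E1 (p^-1 * x + 0)].
pose A0 : set U := [set` `]p, +oo[] `&` [set x | E0 ((1 - p)^-1 * x + (- (1 - p)^-1 * p))].
have mA1 : measurable A1.
  by apply: measurableI; [exact: measurable_itv|exact: measurable_affine].
have mA0 : measurable A0.
  by apply: measurableI; [exact: measurable_itv|exact: measurable_affine].
have AE : A = A1 `|` A0.
  apply/seteqP; split=> x; rewrite /A /A1 /A0 /pstep/= !in_itv/= addr0 andbT.
    have [xp Ex|xp Ex] := leP x p; [by left|right; split=> //].
    by rewrite mulNr -mulrBr.
  have [xp [[_ //]|[//]]|xp [[//]|[_]]] := leP x p.
  by rewrite mulNr -mulrBr.
have A10 : A1 `&` A0 = set0.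
  apply/seteqP; split=> x //=; rewrite /A1 /A0/= !in_itv/= andbT => -[[xp _] [px _]].
  by rewrite ltNge xp in px.
have I_E (B B' : set U) : B `&` [set` `]0, 1]] = B' `&` [set` `]0, 1]] ->
    punif B = punif B'.
  by rewrite /punif /pr /unif /mrestr => e; congr (fine (lebesgue_measure _)).
split; first by rewrite AE; apply: measurableU.
rewrite AE /punif prU// -/punif; congr (_ + _).
  (* For [p = 0] the inverse takes its default value [0], but then the branch [x <= 0] misses []0,
     1]]. The other branch is treated alike for [p = 1]. *)
  have [p00|p00] := eqVneq p 0.
    rewrite p00 mul0r -[RHS](pr0 (@unif R)); apply: I_E; rewrite set0I.
    apply/seteqP; split=> x //=; rewrite /A1/= !in_itv/= p00 => -[[x0 _]].
    by rewrite ltNge x0.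
  have pp : 0 < p by rewrite lt_neqAle eq_sym p00.
  rewrite -[in RHS](invrK p) -(unif_affine (b := 0) _ m1) ?invr_gt0//.
    apply: I_E; apply/seteqP; split=> x /=; rewrite /A1/= !in_itv/= addr0 ![p^-1 * _]mulrC ler_pdivrMr// mul1r.
      move=> [[xp Ex] /andP[x0 x1]]; split; last exact/andP.
      by split=> //; apply/andP; split=> //; apply: divr_gt0.
    by move=> [[Ex /andP[x0 xp]] xI]; split.
  move=> x; rewrite addr0 mulrC ler_pdivrMr// mul1r => /andP[x0 xp].
  rewrite (le_trans xp p1) andbT; move: x0; rewrite pmulr_lgt0// invr_gt0//.
have [p01|p01] := eqVneq p 1.
  rewrite p01 subrr mul0r -[RHS](pr0 (@unif R)); apply: I_E; rewrite set0I.
  apply/seteqP; split=> x //=; rewrite /A0/= !in_itv/= p01 andbT => -[[x1 _] /andP[_]].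
  by rewrite leNgt x1.
have qq : 0 < 1 - p by rewrite subr_gt0 lt_neqAle p01.
rewrite -[in RHS](invrK (1 - p)) -(unif_affine (b := - (1 - p)^-1 * p) _ m0) ?invr_gt0//.
  apply: I_E; apply/seteqP; split=> x /=; rewrite /A0/= !in_itv/= andbT mulNr -mulrBr mulrC ler_pdivrMr// mul1r.
    move=> [[px Ex] /andP[x0 x1]]; split; last exact/andP.
    split=> //; apply/andP; split; last by rewrite lerD2r.
    by apply: divr_gt0 => //; rewrite subr_gt0.
  move=> [[Ex /andP[+ _]] xI]; rewrite pmulr_lgt0 ?invr_gt0// subr_gt0.
  by move=> px; split.
move=> x; rewrite mulNr -mulrBr mulrC ler_pdivrMr// mul1r lerD2r => /andP[+ ->].
rewrite pmulr_lgt0 ?invr_gt0// subr_gt0 andbT; exact: le_lt_trans.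
Qed.

(** Induction on the list: given the first digit the remainder is again uniform, so the other digits
    and the final remainder are read off a fresh uniform variable. *)
Lemma digits_indep (ps : seq R) (S : set (seq bool)) (E : set U) :
  (forall p, p \in ps -> 0 <= p <= 1) -> measurable E ->
  measurable ([set x | S (digits ps x).1 /\ E (digits ps x).2] : set U) /\
  punif [set x | S (digits ps x).1 /\ E (digits ps x).2] =
    punif [set x | S (digits ps x).1] * punif E.
Proof.
elim: ps S E => [|p ps IH] S E p01 mE /=.
  have [S0|S0] := pselect (S [::]).
    rewrite (_ : [set x | _ /\ _] = E); last by apply/seteqP; split=> x // [].
    rewrite (_ : [set x | _] = setT); last by apply/seteqP; split.
    by rewrite /punif prT mul1r.
  rewrite (_ : [set x | _ /\ _] = set0); last by apply/seteqP; split=> x // [].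
  rewrite (_ : [set x | _] = set0); last by apply/seteqP; split.
  by rewrite /punif pr0 mul0r.
have pp : 0 <= p <= 1 by apply: p01; rewrite inE eqxx.
have p01' q : q \in ps -> 0 <= q <= 1 by move=> qps; apply: p01; rewrite inE qps orbT.
(* Stated for every [F], because [F = setT] then identifies the factor in front as the probability
   of the digit event. *)
have key (F : set U) : measurable F ->
   measurable ([set x | S ((pstep p x).1 :: (digits ps (pstep p x).2).1) /\
     F (digits ps (pstep p x).2).2] : set U) /\
   punif [set x | S ((pstep p x).1 :: (digits ps (pstep p x).2).1) /\
     F (digits ps (pstep p x).2).2] =
   (p * punif [set x | S (true :: (digits ps x).1)] +
    (1 - p) * punif [set x | S (false :: (digits ps x).1)]) * punif F.
  move=> mF.
  have [m1 e1] := IH [set s | S (true :: s)] F p01' mF.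
  have [m0 e0] := IH [set s | S (false :: s)] F p01' mF.
  have [mA eA] := unif_pstep pp m0 m1.
  have -> : [set x | S ((pstep p x).1 :: (digits ps (pstep p x).2).1) /\
     F (digits ps (pstep p x).2).2] = [set x | if (pstep p x).1 then
       [set x | S (true :: (digits ps x).1) /\ F (digits ps x).2] (pstep p x).2 else
       [set x | S (false :: (digits ps x).1) /\ F (digits ps x).2] (pstep p x).2].
    by apply/seteqP; split=> x /=; case: (pstep p x).1.
  by split=> //; rewrite eA e0 e1; ring.
have [mA eA] := key E mE; split=> //; rewrite eA; congr (_ * _).
have [_ eT] := key setT measurableT.
rewrite /punif prT mulr1 in eT; rewrite /punif -eT.
by congr pr; apply/seteqP; split=> x // [].
Qed.

(** Beyond the end of the list the defaults agree: digit [false], probability [0]. *)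
Lemma digits_marginal (ps : seq R) v : (forall p, p \in ps -> 0 <= p <= 1) ->
  punif [set x | nth false (digits ps x).1 v] = nth 0 ps v.
Proof.
elim: ps v => [|p ps IH] v p01 /=.
  rewrite [RHS]nth_nil -[RHS](pr0 (@unif R)); congr pr.
  by apply/seteqP; split=> x //=; rewrite nth_nil.
have pp : 0 <= p <= 1 by apply: p01; rewrite inE eqxx.
have p01' q : q \in ps -> 0 <= q <= 1 by move=> qps; apply: p01; rewrite inE qps orbT.
case: v => [|v] /=.
  have [_] := unif_pstep pp (@measurable0 _ U) (@measurableT _ U).
  rewrite /punif prT pr0 mulr1 mulr0 addr0 => {2}<-.
  by congr pr; apply/seteqP; split=> x /=; case: (pstep p x).1.
have [mE _] := digits_indep [set s | nth false s v] p01' (@measurableT _ U).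
have [_] := unif_pstep pp mE mE.
rewrite -mulrDl addrC subrK mul1r -(IH v p01').
rewrite (_ : [set x | _ /\ _] = [set x | nth false (digits ps x).1 v]); last first.
  by apply/seteqP; split=> x //= [].
move=> <-; congr (pr _ _); apply/seteqP; split=> x /=; case: (pstep p x).1 => // -[].
Qed.

End digits.

Lemma sigma_algebra_preimages (T X : Type) (H : set (set X)) (Y : T -> X) :
  sigma_algebra setT H ->
  sigma_algebra setT [set A | exists2 E, H E & A = Y @^-1` E].
Proof.
move=> sH; split=> /=.
- by exists set0; [case: sH|rewrite preimage_set0].
- by move=> _ [E HE ->]; exists (~` E); [exact: sigma_setC|rewrite setTD preimage_setC].
- move=> A AE; have /boolp.choice[E HE] n : exists E, H E /\ A n = Y @^-1` E.
    by have [E] := AE n; exists E.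
  exists (\bigcup_n E n); first by apply: sigma_bigcup => // n _; case: (HE n).
  by rewrite preimage_bigcup; apply: eq_bigcupr => n _; case: (HE n).
Qed.

(** A parameterization must be real-valued; since [pickle] is injective, the code carries the same
    information as the list of digits. *)
Definition digit_code (R : realType) (T : Type) (B : nat -> T -> seq bool) : nat -> T -> R :=
  fun k w => (pickle (B k w))%:R.

Lemma code_preimage (R : realType) (T : Type) (B : nat -> T -> seq bool)
  (I : set nat) k S : I k -> sigma_real I (digit_code R B) (B k @^-1` S).
Proof.
move=> Ik; apply: sigma_preimage; first exact: smallest_sigma_algebra.
move=> s; apply: sub_sigma_algebra; exists k, [set (pickle s)%:R]; split=> //.
split; first exact: measurable_set1.
apply/seteqP; split=> w; rewrite /digit_code/=; first by move=> ->.
by move=> /eqP; rewrite eqr_nat => /eqP /(pcan_inj pickleK).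
Qed.

Lemma sigma_real_code (R : realType) (T : Type) (B : nat -> T -> seq bool) k A :
  sigma_real [set k] (digit_code R B) A -> exists S, A = B k @^-1` S.
Proof.
have sH : sigma_algebra setT [set: set (seq bool)] by split.
move=> sA; suff [S _ ->] : exists2 S, [set: set (seq bool)] S & A = B k @^-1` S by exists S.
apply: (smallest_sigma_sub (sigma_algebra_preimages (B k) sH)) sA => _ [_ [D [-> [_ ->]]]].
by exists [set s | D (pickle s)%:R].
Qed.

(** * Digits of all levels from a single uniform variable *)

Section sequence.
Context (R : realType) (ps : nat -> seq R).
Hypothesis ps01 : forall k p, p \in ps k -> 0 <= p <= 1.
Let U := measurableTypeR R.
Let punif := pr (@unif R).

(** Level 0 is read first, so [remainder k] still holds the digits of every index [>= k], that is,
    of the past of level [-k]. *)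
Fixpoint remainder k (x : U) : U :=
  if k is k'.+1 then (digits (ps k') (remainder k' x)).2 else x.

Definition digit_seq k (x : U) : seq bool := (digits (ps k) (remainder k x)).1.

Let mH : sigma_algebra setT (@measurable _ U) := @sigma_algebra_measurable _ U.

Lemma remainder_measurable k (E : set U) : measurable E ->
  measurable (remainder k @^-1` E) /\ punif (remainder k @^-1` E) = punif E.
Proof.
elim: k E => [|k IH] E mE; first by [].
have [m e] := digits_indep setT (@ps01 k) mE.
have [m' e'] := IH _ m.
have -> : remainder k.+1 @^-1` E = remainder k @^-1`
    [set x | setT (digits (ps k) x).1 /\ E (digits (ps k) x).2].
  by apply/seteqP; split=> x //= [].
split=> //; apply: (etrans e'); apply: (etrans e).
rewrite (_ : [set x | _] = setT); last by apply/seteqP; split.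
by rewrite prT mul1r.
Qed.

Lemma remainder_tail k n (E : set U) : measurable E ->
  exists2 E' : set U, measurable E' & remainder (k + n) @^-1` E = remainder k @^-1` E'.
Proof.
elim: n E => [|n IH] E mE; first by exists E => //; rewrite addn0.
have [m _] := digits_indep setT (@ps01 (k + n)%N) mE.
have [E' mE' eE'] := IH _ m; exists E' => //; rewrite -eE' addnS.
by apply/seteqP; split=> x //= [].
Qed.

Lemma digit_preimage k S : exists2 E : set U, measurable E &
  digit_seq k @^-1` S = remainder k @^-1` E.
Proof.
have [m _] := digits_indep S (@ps01 k) (@measurableT _ U).
exists [set x | S (digits (ps k) x).1] => //.
by move: m; congr measurable; apply/seteqP; split=> x //= [].
Qed.

Lemma sigma_real_remainder k (A : set U) :
  sigma_real [set j | (k <= j)%N] (digit_code R digit_seq) A ->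
  exists2 E : set U, measurable E & A = remainder k @^-1` E.
Proof.
apply: (smallest_sigma_sub (sigma_algebra_preimages (remainder k) mH)).
move=> _ [j [D [/= kj [_ ->]]]].
have [E mE eE] := digit_preimage j [set s | D (pickle s)%:R].
have [E' mE' eE'] := remainder_tail k (j - k) mE; rewrite subnKC// in eE'.
by exists E' => //; rewrite -eE' -eE.
Qed.

(** The digits of index [k] and [remainder k.+1] are the two components of [digits] applied to the
    uniform variable [remainder k], and the past is a function of the second one. *)
Lemma digit_seq_indep k (A C : set U) :
  sigma_real [set k] (digit_code R digit_seq) A ->
  sigma_real [set j | (k.+1 <= j)%N] (digit_code R digit_seq) C ->
  [/\ measurable A, measurable C & punif (A `&` C) = punif A * punif C].
Proof.
move=> /sigma_real_code[S ->] /sigma_real_remainder[E mE ->].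
have [mC eC] := remainder_measurable k.+1 mE.
have [D mD eD] := digit_preimage k S.
have [mS eS] := remainder_measurable k mD.
split=> //; first by rewrite eD.
have [m e] := digits_indep S (@ps01 k) mE.
have [m' e'] := remainder_measurable k m.
have [m2 e2] := digits_indep S (@ps01 k) (@measurableT _ U).
have [m2' e2'] := remainder_measurable k m2.
rewrite eC; transitivity (punif (remainder k @^-1`
  [set x | S (digits (ps k) x).1 /\ E (digits (ps k) x).2])); first by [].
apply: (etrans e'); apply: (etrans e); congr (_ * _).
transitivity (punif [set x | S (digits (ps k) x).1 /\ setT (digits (ps k) x).2]).
  by congr punif; apply/seteqP; split=> x //= [].
by apply: (etrans (esym e2')); congr punif; apply/seteqP; split=> x //= [].
Qed.

Lemma digit_seq_marginal k v :
  punif [set x | nth false (digit_seq k x) v] = nth 0 (ps k) v.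
Proof.
rewrite -(digits_marginal v (@ps01 k)) -/punif.
have [m _] := digits_indep [set s | nth false s v] (@ps01 k) (@measurableT _ U).
rewrite (_ : [set x | _ /\ _] = [set x | nth false (digits (ps k) x).1 v]) in m; last first.
  by apply/seteqP; split=> x // [].
by have [_ <-] := remainder_measurable k m.
Qed.

End sequence.

(** * Monotone coupling *)

Lemma neq_measurable d (T : measurableType d) (Z Z' : T -> nat) :
  (forall j, measurable (Z @^-1` [set j])) ->
  (forall j, measurable (Z' @^-1` [set j])) -> measurable [set w | Z w != Z' w].
Proof.
move=> mZ mZ'.
rewrite (_ : [set w | _] = ~` \bigcup_j (Z @^-1` [set j] `&` Z' @^-1` [set j])).
  by apply/measurableC/bigcupT_measurable => j; apply: measurableI.
apply/seteqP; split=> w /= => [/eqP ZN [j _ [Zj Zj']]|H].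
  by apply: ZN; rewrite Zj Zj'.
by apply/eqP => ZE; apply: H; exists (Z' w).
Qed.

(** For integers [Z <= Z'], the indicator of [Z != Z'] is at most [Z' - Z]; the proof sums this over
    the joint values. *)
Lemma pr_neq_le d (R : realType) (T : measurableType d) (Q : probability T R)
  n (Z Z' : T -> nat) C :
  (forall w, (Z w <= Z' w < n)%N) ->
  (forall j, measurable (Z @^-1` [set j])) ->
  (forall j, measurable (Z' @^-1` [set j])) -> measurable C ->
  pr Q ([set w | Z w != Z' w] `&` C) <=
  wsum Q n (fun j => j%:R) Z' C - wsum Q n (fun j => j%:R) Z C.
Proof.
move=> ZZ' mZ mZ' mC.
have Zn w : (Z w < n)%N by have := ZZ' w; lia.
have Zn' w : (Z' w < n)%N by have := ZZ' w; lia.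
pose E i j := Z @^-1` [set i] `&` (Z' @^-1` [set j] `&` C).
have -> : wsum Q n (fun j => j%:R) Z' C =
    \sum_(i < n) \sum_(j < n) j%:R * pr Q (E i j).
  rewrite exchange_big; apply: eq_bigr => j _; rewrite -mulr_sumr pr_partition//.
  exact: measurableI.
have -> : wsum Q n (fun j => j%:R) Z C =
    \sum_(i < n) \sum_(j < n) i%:R * pr Q (E i j).
  apply: eq_bigr => i _; rewrite -mulr_sumr -(pr_partition Q Zn' mZ').
    by congr (_ * _); apply: eq_bigr => j _; rewrite setICA.
  exact: measurableI.
have mN := neq_measurable mZ mZ'.
have mNC := measurableI _ _ mN mC.
rewrite -sumrB -(pr_partition Q Zn mZ mNC); apply: ler_sum => i _.
have mi : measurable (Z @^-1` [set i : nat] `&` ([set w | Z w != Z' w] `&` C)).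
  exact: measurableI.
rewrite -sumrB -(pr_partition Q Zn' mZ' mi); apply: ler_sum => j _.
rewrite -mulrBl.
have [ij|ij] := ltnP i j.
  apply: (@le_trans _ _ (1 * pr Q (E i j))).
    rewrite mul1r; apply: le_pr => //; rewrite /E.
    - by apply: measurableI.
    - by do 2 ?apply: measurableI.
    - by move=> w [Zj [Zi [_ Cw]]].
  rewrite ler_wpM2r ?pr_ge0//.
  by rewrite lerBrDr nat1r ler_nat.
rewrite (_ : _ `&` _ = set0).
  rewrite pr0; move: ij; rewrite leq_eqVlt => /predU1P[->|ji].
    by rewrite subrr mul0r.
  rewrite (_ : E i j = set0) ?pr0 ?mulr0//.
  by apply/seteqP; split=> w //= [Zi [Zj _]]; have := ZZ' w; rewrite Zi Zj; lia.
apply/seteqP; split=> w //= [Zj [Zi [/eqP Zn0 _]]]; have := ZZ' w.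
by rewrite Zi Zj in Zn0 *; lia.
Qed.

(* The minimum with [k] and the truncated subtraction force the move from [k + 1] to [k]
   and the stay at [0], whatever the digit. *)
Definition phi k v (s : seq bool) : nat := minn k (v - nth false s v).

Lemma phi_le k v s : (phi k v s <= k)%N.
Proof. exact: geq_minl. Qed.

(* From vertex [v] one moves to [v] or [v - 1], so that any two transitions preserve the order. *)
Lemma phi_mono k s v v' : (v <= v')%N -> (phi k v s <= phi k v' s)%N.
Proof.
rewrite leq_eqVlt => /predU1P[->//|vv']; rewrite /phi.
by case: (nth _ _ _); case: (nth _ _ _); lia.
Qed.

(** The law of [phi k b] when the digit read at [b] is [true] with probability [q k b]. *)
Definition pascal_kern (R : realType) (q : nat -> nat -> R) k b a : R :=
  q k b * (minn k b.-1 == a)%:R + (1 - q k b) * (minn k b == a)%:R.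

Section run.
Context d (R : realType) (T : measurableType d) (Q : probability T R).
Variables (B : nat -> T -> seq bool) (q : nat -> nat -> R).
Let G k := sigma_real [set j | (k <= j)%N] (digit_code R B).
Let kern := pascal_kern q.
Hypothesis indB : forall k A C, sigma_real [set k] (digit_code R B) A -> G k.+1 C ->
  [/\ measurable A, measurable C & pr Q (A `&` C) = pr Q A * pr Q C].
Hypothesis lawB : forall k v, pr Q [set w | nth false (B k w) v] = q k v.

Lemma code_sigma k : sigma_algebra setT (G k).
Proof. exact: smallest_sigma_algebra. Qed.

Lemma code_sigma_le k j : (k <= j)%N -> G j `<=` G k.
Proof.
move=> kj; apply: sub_sigma_algebra2 => A [i [D [/= ji H]]].
by exists i, D; split => //=; apply: leq_trans ji.
Qed.

Lemma digit_measurable k S : measurable (B k @^-1` S).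
Proof.
by have [] := indB (@code_preimage R T B [set k] k S (erefl k)) (sigma_setT (@code_sigma k.+1)).
Qed.

Lemma code_sigma_measurable k A : G k A -> measurable A.
Proof.
apply: smallest_sigma_sub; first exact: sigma_algebra_measurable.
move=> _ [j [D [_ [_ ->]]]].
exact: (@digit_measurable j [set s | D (pickle s)%:R]).
Qed.

Lemma code_sigma_digit k j S : (k <= j)%N -> G k (B j @^-1` S).
Proof. by move=> kj; apply: code_preimage. Qed.

Lemma phi_law k b a : pr Q [set w | phi k b (B k w) = a] = kern k b a.
Proof.
have mE := @digit_measurable k [set s | nth false s b].
have mA := @digit_measurable k [set s | phi k b s = a].
rewrite -[LHS]/(pr Q (B k @^-1` [set s | phi k b s = a])) (prIC Q mE mA).
have qE : pr Q (B k @^-1` [set s | nth false s b]) = q k b by rewrite -lawB.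
have qE' : pr Q (~` (B k @^-1` [set s | nth false s b])) = 1 - q k b.
  have := prIC Q mE (@measurableT _ T); rewrite !setIT prT qE => ->.
  by rewrite addrC addKr.
rewrite /kern /pascal_kern; congr (_ + _).
  have [ea|na] := eqVneq (minn k b.-1) a.
    rewrite mulr1 -qE; congr pr; apply/seteqP; split=> w /=; first by case.
    by rewrite /phi => bT; rewrite bT subn1; split.
  rewrite mulr0 -[RHS](pr0 Q); congr pr; apply/seteqP; split=> w //= [bT].
  by rewrite /phi bT subn1 => /eqP; rewrite (negPf na).
have [ea|na] := eqVneq (minn k b) a.
  rewrite mulr1 -qE'; congr pr; apply/seteqP; split=> w /=; first by case.
  by rewrite /phi => /negP/negPf bT; rewrite bT subn0; split.
rewrite mulr0 -[RHS](pr0 Q); congr pr; apply/seteqP; split=> w //= [/negP/negPf bT].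
by rewrite /phi bT subn0 => /eqP; rewrite (negPf na).
Qed.

(** On [Z = b] the transition depends only on the digits of index [k], which are independent of
    [G k.+1]. *)
Lemma phi_step k (Z : T -> nat) C a b : G k.+1 (Z @^-1` [set b]) -> G k.+1 C ->
  pr Q ([set w | phi k (Z w) (B k w) = a] `&` (Z @^-1` [set b] `&` C)) =
  kern k b a * pr Q (Z @^-1` [set b] `&` C).
Proof.
move=> GZ GC; have GZC := sigma_setI (@code_sigma k.+1) GZ GC.
have [_ _] := indB (@code_preimage R T B [set k] k [set s | phi k b s = a] (erefl k)) GZC.
rewrite -phi_law => <-; congr pr.
by apply/seteqP; split=> w /= [+ [Zb Cw]]; rewrite Zb.
Qed.

(** Position at level [-k] of the copy started from [x] at level [-(k + n)]. *)
Fixpoint run k n x w : nat :=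
  if n is n'.+1 then phi k (run k.+1 n' x w) (B k w) else x.

Lemma run_cat k n l x w : run k (n + l) x w = run k n (run (k + n) l x w) w.
Proof. by elim: n k => [|n IH] k /=; [rewrite addn0|rewrite IH addnS addSn]. Qed.

Lemma run_mono k n x y w : (x <= y)%N -> (run k n x w <= run k n y w)%N.
Proof. by move=> xy; elim: n k => [|n IH] k //=; apply: phi_mono. Qed.

Lemma run_le k n x w : (x <= k + n)%N -> (run k n x w < k.+1)%N.
Proof. by case: n => [|n] /=; [rewrite addn0 ltnS|rewrite ltnS phi_le]. Qed.

Lemma run_sigma k n x S : G k (run k n x @^-1` S).
Proof.
elim: n k S => [|n IH] k S.
  have [xS|xS] := pselect (S x).
    rewrite (_ : _ @^-1` _ = setT); first exact: sigma_setT (@code_sigma k).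
    by apply/seteqP; split.
  rewrite (_ : _ @^-1` _ = set0); first by case: (@code_sigma k).
  by apply/seteqP; split.
have -> : run k n.+1 x @^-1` S = \bigcup_v
    (run k.+1 n x @^-1` [set v] `&` B k @^-1` [set s | S (phi k v s)]).
  apply/seteqP; split=> w /=; first by move=> Sw; exists (run k.+1 n x w).
  by case=> v _ [/= ->].
apply: (sigma_bigcup (@code_sigma k)) => v _; apply: (sigma_setI (@code_sigma k)).
  exact: code_sigma_le (leqnSn k) _ (IH k.+1 [set v]).
exact: code_sigma_digit.
Qed.

Lemma run_measurable k n x S : measurable (run k n x @^-1` S).
Proof. exact: code_sigma_measurable (@run_sigma k n x S). Qed.

(** The copy uses the digits of indices [k] to [k + n - 1] only, hence is independent of
    [G (k + n)]; its mean obeys the recursion defining [bop]. Thus [bop] can be studied through the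
    coupling. *)
Lemma wsum_run k n x f C : (x <= k + n)%N -> G (k + n) C ->
  wsum Q k.+1 f (run k n x) C = bop kern k n f x * pr Q C.
Proof.
elim: n k f => [|n IH] k f xn GC /=.
  rewrite addn0 in xn; rewrite /wsum (bigD1 (Ordinal (xn : x < k.+1)%N))//=.
  rewrite big1 => [|j].
    rewrite addr0; congr (_ * pr Q _); apply/seteqP; split=> w; first by case.
    by split.
  rewrite -val_eqE/= => jx; rewrite (_ : _ `&` _ = set0) ?pr0 ?mulr0//.
  by apply/seteqP; split=> w //= [xj]; rewrite xj eqxx in jx.
have mC := code_sigma_measurable GC.
rewrite addnS -addSn in xn GC.
rewrite (wsum_step (n' := k.+2) _ f _ _ _ mC (K := kern k) (Z' := run k.+1 n x)).
- by rewrite -IH.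
- by move=> w; apply: run_le.
- by move=> j; exact: (@run_measurable k n.+1 x [set j]).
- by move=> j; apply: run_measurable.
- move=> a b; apply: phi_step; first exact: run_sigma.
  by apply: code_sigma_le GC; lia.
Qed.

Lemma bop_run k n x f : (x <= k + n)%N ->
  bop kern k n f x = wsum Q k.+1 f (run k n x) setT.
Proof.
by move=> xn; rewrite wsum_run// ?prT ?mulr1//; exact: sigma_setT (@code_sigma _).
Qed.

Let e k n := bop kern k n (fun j => j%:R).

Lemma run_neq_measurable k n x n' x' :
  measurable [set w | run k n x w != run k n' x' w].
Proof. by apply: neq_measurable => j; apply: run_measurable. Qed.

(** The copies are ordered by [run_mono], so [pr_neq_le] bounds their disagreement by the difference
    of their means. *)
Lemma run_neq k n x y C : (x <= k + n)%N -> (y <= k + n)%N -> G (k + n) C ->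
  pr Q ([set w | run k n x w != run k n y w] `&` C) <=
  `|e k n y - e k n x| * pr Q C.
Proof.
wlog xy : x y / (x <= y)%N.
  move=> H xn yn GC; have [xy|/ltnW yx] := leqP x y; first exact: H.
  rewrite distrC (_ : [set w | _] = [set w | run k n y w != run k n x w]).
    exact: H.
  by apply/seteqP; split=> w /=; rewrite eq_sym.
move=> xn yn GC; have mC := code_sigma_measurable GC.
apply: (@le_trans _ _ ((e k n y - e k n x) * pr Q C)); last first.
  by rewrite ler_wpM2r ?pr_ge0 ?ler_norm.
rewrite mulrBl -!wsum_run//; apply: pr_neq_le => //.
- by move=> w; rewrite run_mono//= run_le.
- by move=> j; apply: run_measurable.
- by move=> j; apply: run_measurable.
Qed.

(** Condition on the position [y] of the longer run at level [-(k + n)]: from there on it is the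
    copy started from [y], and [run_neq] applies. *)
Lemma run_switch k n l x x' : (x <= k + n)%N -> (x' <= k + n + l)%N ->
  pr Q [set w | run k n x w != run k (n + l) x' w] <=
  bop kern (k + n) l (fun y => `|e k n y - e k n x|) x'.
Proof.
move=> xn xl; rewrite bop_run//; set Y := run (k + n) l x'.
have mY j : measurable (Y @^-1` [set j]) by apply: run_measurable.
have Yn w : (Y w < (k + n).+1)%N by apply: run_le.
rewrite -(pr_partition Q Yn mY); last exact: run_neq_measurable.
apply: ler_sum => y _; rewrite setIT.
have yn : (y <= k + n)%N by rewrite -ltnS.
apply: (@le_trans _ _ (pr Q ([set w | run k n x w != run k n y w] `&` Y @^-1` [set y : nat]))).
  apply: le_pr.
  - by apply: measurableI; [exact: mY|exact: run_neq_measurable].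
  - by apply: measurableI; [exact: run_neq_measurable|exact: mY].
  - by move=> w /= [Yw]; rewrite run_cat -/Y Yw.
by apply: run_neq => //; apply: run_sigma.
Qed.

(** The copies from [x] and [y] give [g] the same value unless they differ, an event bounded by
    [run_neq] on which the values of [g] are at most [M] apart. *)
Lemma bop_lip k n M g x y : (forall j, (j <= k)%N -> 0 <= g j <= M) ->
  (x <= k + n)%N -> (y <= k + n)%N ->
  `|bop kern k n g x - bop kern k n g y| <= M * `|e k n y - e k n x|.
Proof.
move=> gM.
have M0 : 0 <= M by have /andP[] := gM 0%N isT; apply: le_trans.
suff H u v : (u <= k + n)%N -> (v <= k + n)%N ->
    bop kern k n g u - bop kern k n g v <= M * `|e k n v - e k n u|.
  move=> xn yn; rewrite ler_norml; apply/andP; split; last exact: H.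
  by rewrite lerNl opprB distrC H.
move=> un vn; rewrite !bop_run//.
have mZ z j : measurable (run k n z @^-1` [set j]) by apply: run_measurable.
set A := [set w | run k n u w != run k n v w].
have mA : measurable A by exact: run_neq_measurable.
have mT := @measurableT _ T.
rewrite (wsum_split Q _ g (mZ u) mA mT) (wsum_split Q _ g (mZ v) mA mT) !setIT.
have -> : wsum Q k.+1 g (run k n u) (~` A) = wsum Q k.+1 g (run k n v) (~` A).
  apply: eq_bigr => j _; congr (_ * pr Q _).
  apply/seteqP; split=> w; rewrite /A /= => -[Zj nZ]; split=> //;
    by move/negP: nZ; rewrite negbK => /eqP E; rewrite -Zj E.
have H1 : wsum Q k.+1 g (run k n u) A <= M * pr Q A.
  rewrite -(wsum_cst Q M (n := k.+1) _ (mZ u) mA); last by move=> w; apply: run_le.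
  by apply: wsum_le => j; rewrite ltnS => /gM/andP[].
have H2 : 0 <= wsum Q k.+1 g (run k n v) A.
  apply: sumr_ge0 => j _; rewrite mulr_ge0 ?pr_ge0//.
  by have /andP[] := gM j (ltn_ord j).
have H3 : M * pr Q A <= M * `|e k n v - e k n u|.
  rewrite ler_wpM2l// -[A]setIT -[leRHS]mulr1 -(prT Q); apply: run_neq => //.
  exact: sigma_setT (@code_sigma _).
lra.
Qed.

Lemma e_bounds k n x : (x <= k + n)%N -> 0 <= e k n x <= k%:R.
Proof.
move=> xn; rewrite /e bop_run//; apply/andP; split; first exact: wsum_ge0.
have Zk w : (run k n x w < k.+1)%N by apply: run_le.
have := @wsum_cst _ _ _ Q k.+1 k%:R (run k n x) setT Zk (fun j => run_measurable _ _ _ _) measurableT.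
rewrite prT mulr1 => <-.
by apply: wsum_le => j; rewrite ltnS ler_nat.
Qed.

End run.

(** * The limit process *)

Section LimitProcess.
Import numFieldNormedType.Exports.

(** * Upper limits of bounded integer sequences *)

Definition is_limsup (u : nat -> nat) (L : nat) : Prop :=
  (forall I, exists2 i, (I <= i)%N & u i = L) /\
  (exists I, forall i, (I <= i)%N -> (u i <= L)%N).

(** Induction on the bound: either it is attained infinitely often, or it can be lowered by one. *)
Lemma is_limsup_exists (u : nat -> nat) (k : nat) :
  (exists I, forall i, (I <= i)%N -> (u i <= k)%N) -> exists L, is_limsup u L.
Proof.
elim: k => [|k IH] [I0 HI0].
  exists 0%N; split; last by exists I0.
  move=> I; exists (maxn I I0); first exact: leq_maxl.
  by have := HI0 (maxn I I0) (leq_maxr _ _); lia.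
have [io|nio] := pselect (forall I, exists2 i, (I <= i)%N & u i = k.+1).
  by exists k.+1; split => //; exists I0.
apply: IH; move/existsNP: nio => [I1 nI1].
exists (maxn I0 I1) => i; rewrite geq_max => /andP[i0 i1].
have := HI0 i i0; rewrite leq_eqVlt => /predU1P[ui|//].
by exfalso; apply: nI1; exists i.
Qed.

Lemma is_limsup_unique (u : nat -> nat) L L' :
  is_limsup u L -> is_limsup u L' -> L = L'.
Proof.
move=> [ioL [I evL]] [ioL' [I' evL']]; apply/eqP; rewrite eqn_leq.
have [i Ii ui] := ioL I'; have [i' Ii' ui'] := ioL' I.
by rewrite -{1}ui evL'// -ui' evL.
Qed.

(** Through this the limit process satisfies its recursion at every point, not just almost surely;
    the inclusions asked of a parameterization are exact, not up to null sets. *)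
Lemma is_limsup_mono (u v : nat -> nat) (f : nat -> nat) L :
  {homo f : x y / (x <= y)%N} ->
  (exists I, forall i, (I <= i)%N -> v i = f (u i)) ->
  is_limsup u L -> is_limsup v (f L).
Proof.
move=> fmono [I0 vE] [ioL [I1 evL]]; split.
  move=> I; have [i] := ioL (maxn I I0); rewrite geq_max => /andP[Ii I0i] uL.
  by exists i => //; rewrite vE// uL.
exists (maxn I0 I1) => i; rewrite geq_max => /andP[I0i I1i].
by rewrite vE//; apply: fmono; apply: evL.
Qed.

Lemma is_limsup_cst (u : nat -> nat) L I :
  (forall i, (I <= i)%N -> u i = L) -> is_limsup u L.
Proof.
move=> uL; split; last by exists I => i /uL->.
by move=> J; exists (maxn I J); [exact: leq_maxr|apply: uL; exact: leq_maxl].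
Qed.

(** * Copies started at remote levels and their limit *)

Section law.
Context d (R : realType) (T : measurableType d) (P : probability T R).
Variables (V : nat -> T -> nat) (q : nat -> nat -> R).
Let kern := pascal_kern q.
Hypothesis mV : forall k j, measurable (V k @^-1` [set j]).
Hypothesis Vk : forall k w, (V k w < k.+1)%N.
Hypothesis cV : chain P V kern.
Hypothesis tV : tail_trivial P V.

Let e k n := bop kern k n (fun j => j%:R).
Let a k m x := wsum P m.+1 (fun y => `|e k (m - k) y - e k (m - k) x|) (V m) setT.

(** The levels are chosen recursively. The factor [1 / (m i).+1] pays for later applying [start_law]
    at level [- m i] to functions bounded by [(m i).+1]. *)
Lemma exists_starts : exists m x : nat -> nat,
  [/\ forall i, (m i < m i.+1)%N, forall i, (x i <= m i)%N &
      forall i k, (k <= m i)%N ->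
        a k (m i.+1) (x i.+1) <= 2^-1 ^+ i / (m i).+1%:R].
Proof.
have /boolp.choice[F HF] (Ki : nat * nat) : exists mx : nat * nat,
    [/\ (Ki.1 < mx.1)%N, (mx.2 <= mx.1)%N & forall k, (k <= Ki.1)%N ->
      a k mx.1 mx.2 <= 2^-1 ^+ Ki.2 / Ki.1.+1%:R].
  have e0 : 0 < 2^-1 ^+ Ki.2 / Ki.1.+1%:R :> R by rewrite divr_gt0// exprn_gt0.
  by have [m [x H]] := exists_start Ki.1 mV Vk cV tV e0; exists (m, x).
pose fix s i := if i is i'.+1 then F ((s i').1, i') else F (0%N, 0%N).
exists (fun i => (s i).1), (fun i => (s i).2); split.
- by move=> i; have [] := HF ((s i).1, i).
- by case=> [|i]; [have [] := HF (0%N, 0%N)|have [] := HF ((s i).1, i)].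
- by move=> i k ki; have [_ _] := HF ((s i).1, i); apply.
Qed.

Context d' (T' : measurableType d') (Q : probability T' R).
Variables (B : nat -> T' -> seq bool).
Let G k := sigma_real [set j | (k <= j)%N] (digit_code R B).
Hypothesis indB : forall k A C, sigma_real [set k] (digit_code R B) A -> G k.+1 C ->
  [/\ measurable A, measurable C & pr Q (A `&` C) = pr Q A * pr Q C].
Hypothesis lawB : forall k v, pr Q [set w | nth false (B k w) v] = q k v.

(** The mean of [g (V k)] is the average of [bop] over [V m]; replacing [V m] by the fixed vertex
    [x] is controlled by [bop_lip]. *)
Lemma start_law k m x g M : (forall j, (j <= k)%N -> 0 <= g j <= M) ->
  (k <= m)%N -> (x <= m)%N ->
  `|bop kern k (m - k) g x - wsum P k.+1 g (V k) setT| <= M * a k m x.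
Proof.
move=> gM km xm; have FT := sigma_setT (@natfil_sigma _ V (k + (m - k))).
rewrite (wsum_bop mV Vk cV g FT) subnKC//.
have := @wsum_cst _ _ _ P m.+1 (bop kern k (m - k) g x) _ setT (Vk m) (mV m) measurableT.
rewrite prT mulr1 => <-; rewrite /a -wsumZ /wsum -sumrB.
apply: (le_trans (ler_norm_sum _ _ _)); apply: ler_sum => y _.
rewrite -mulrBl normrM (ger0_norm (pr_ge0 _ _)) ler_wpM2r ?pr_ge0//.
have ym : (y <= m)%N by rewrite -ltnS.
by apply: (bop_lip indB lawB) => //; rewrite subnKC.
Qed.

Lemma exists_limit_process : exists V' : nat -> T' -> nat,
  [/\ forall k w, V' k w = phi k (V' k.+1 w) (B k w),
      forall k S, G k (V' k @^-1` S) &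
      forall k j, pr Q (V' k @^-1` [set j]) = pr P (V k @^-1` [set j])].
Proof.
have [m [x [mm xm am]]] := exists_starts.
have mi i : (i <= m i)%N by elim: i => // i IH; have := mm i; lia.
pose W i k w := run B k (m i.+1 - k) (x i.+1) w.
have Wk i k w : (k <= i)%N -> (W i k w <= k)%N.
  move=> ki; rewrite -ltnS; apply: run_le; rewrite subnKC ?xm//.
  by have := mi i.+1; lia.
have /boolp.choice[V' V'P] (kw : nat * T') : exists L, is_limsup (W ^~ kw.1 ^~ kw.2) L.
  by apply: (@is_limsup_exists _ kw.1); exists kw.1 => i; apply: Wk.
pose V'' k w := V' (k, w).
have V''P k w : is_limsup (W ^~ k ^~ w) (V'' k w) := V'P (k, w).
have GW k i S : G k (W i k @^-1` S) by exact: run_sigma.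
have sG i : sigma_algebra setT (G i) := @code_sigma d' R T' B i.
have GV k S : G k (V'' k @^-1` S).
  apply: (sigma_preimage (sG k)) => L.
  (* Being an upper limit is a countable combination of events of the copies, all of which lie in
     [G k]. *)
  have -> : V'' k @^-1` [set L] =
      (\bigcap_I \bigcup_(i in [set i | (I <= i)%N]) W i k @^-1` [set L]) `&`
      (\bigcup_I \bigcap_(i in [set i | (I <= i)%N]) W i k @^-1` [set j | (j <= L)%N]).
    apply/seteqP; split=> w /=.
      move=> <-; have [io [I ev]] := V''P k w; split.
        by move=> J _; have [i Ji WL] := io J; exists i.
      by exists I => // i /= /ev.
    move=> [io [I _ ev]]; apply: is_limsup_unique (V''P k w) _; split.
      by move=> J; have [i /= Ji WL] := io J Logic.I; exists i.
    by exists I => i; apply: ev.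
  apply: (sigma_setI (sG k)).
    apply: (sigma_bigcap (sG k)) => I _.
    by apply: (sigma_bigcup (sG k)) => i _; apply: GW.
  apply: (sigma_bigcup (sG k)) => I _.
  by apply: (sigma_bigcap (sG k)) => i _; apply: GW.
exists V''; split=> //.
  move=> k w; apply: is_limsup_unique (V''P k w) _.
  apply: (is_limsup_mono (u := W ^~ k.+1 ^~ w) (f := fun v => phi k v (B k w))) => //.
    by move=> u v; apply: phi_mono.
  (* For [i >= k] the copy starts strictly before level [-k], so at least one transition remains to
     unfold. *)
  exists k => i ki; rewrite /W.
  have -> : (m i.+1 - k = (m i.+1 - k.+1).+1)%N by have := mi i.+1; lia.
  by [].
move=> k j.
have mW i k' j' : measurable (W i k' @^-1` [set j']) by exact: (run_measurable indB).
pose N i := [set w | W i k w != W i.+1 k w].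
have mN i : measurable (N i) by exact: neq_measurable.
(* By [run_switch] the probability is at most the mean of [g] at the position of the next copy. One
   [2^-1 ^+ i] bounds the mean of [g (V (m i.+1))], the other the cost of replacing that vertex by
   the copy. *)
have prN i : (k <= i)%N -> pr Q (N i) <= 2 * 2^-1 ^+ i.
  move=> ki; have kmi : (k <= m i)%N by have := mi i; lia.
  have km : (k <= m i.+1)%N by have := mm i; lia.
  pose n := (m i.+1 - k)%N; pose l := (m i.+2 - m i.+1)%N.
  have nE : (k + n = m i.+1)%N by rewrite subnKC.
  have lE : (m i.+1 + l = m i.+2)%N by rewrite subnKC// ltnW.
  pose g y := `|e k n y - e k n (x i.+1)|.
  have := run_switch indB lawB (k := k) (n := n) (l := l) (x := x i.+1) (x' := x i.+2).
  rewrite nE lE => /(_ (xm _) (xm _)).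
  rewrite (_ : (n + l)%N = (m i.+2 - k)%N); last by lia.
  rewrite -/(N i) => /le_trans; apply; rewrite -/kern -/(e k n) -/g.
  have gM y : (y <= m i.+1)%N -> 0 <= g y <= (m i.+1).+1%:R.
    move=> ym; rewrite /g normr_ge0/=.
    have /andP[e0 ek] := e_bounds indB lawB (k := k) (n := n) (x := y) ltac:(by rewrite nE).
    have /andP[e0' ek'] := e_bounds indB lawB (k := k) (n := n) (x := x i.+1) ltac:(by rewrite nE).
    have : k%:R <= (m i.+1).+1%:R :> R by rewrite ler_nat; lia.
    by rewrite ler_norml -/kern -/(e k n) in e0 ek e0' ek' * => ?; apply/andP; split; lra.
  have := start_law gM (ltnW (mm i.+1)) (xm i.+2).
  have H1 : wsum P (m i.+1).+1 g (V (m i.+1)) setT <= 2^-1 ^+ i.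
    apply: (le_trans (am i k kmi)); rewrite ler_pdivrMr// ler_peMr ?exprn_ge0//.
    by rewrite ler1n.
  have H2 : (m i.+1).+1%:R * a (m i.+1) (m i.+2) (x i.+2) <= 2^-1 ^+ i.
    apply: (@le_trans _ _ (2^-1 ^+ i.+1)).
      by rewrite mulrC -ler_pdivlMr//; apply: am.
    by rewrite exprS ler_piMl ?exprn_ge0//; lra.
  by rewrite ler_norml => /andP[_]; rewrite -/l; lra.
have prNU I : (k <= I)%N -> pr Q (\bigcup_j N (I + j)%N) <= 4 * 2^-1 ^+ I.
  move=> kI; apply: pr_bigcup_le => // n.
  (* The exact geometric sum, in a form that passes through induction. *)
  suff : pr Q (\bigcup_(j in `I_n) N (I + j)%N) <= 4 * 2^-1 ^+ I * (1 - 2^-1 ^+ n).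
    move=> /le_trans; apply; apply: ler_piMr; first by rewrite mulr_ge0 ?exprn_ge0.
    by rewrite gerBl exprn_ge0.
  elim: n => [|n IH].
    rewrite (_ : \bigcup_(_ in _) _ = set0) ?pr0 ?expr0 ?subrr ?mulr0//.
    by apply/seteqP; split=> w // [].
  have -> : \bigcup_(j in `I_n.+1) N (I + j)%N = \bigcup_(j in `I_n) N (I + j)%N `|` N (I + n)%N.
    by rewrite !bigcup_mkord big_ord_recr.
  apply: (le_trans (pr_leU _ _ _)) => //; first by apply: bigcup_measurable.
  have := prN (I + n)%N (leq_trans kI (leq_addr _ _)).
  rewrite exprD exprS; nra.
apply/eqP; rewrite -subr_eq0 -normr_le0; apply/ler_addgt0Pl => ep ep0; rewrite addr0.
(* Four units for the disagreements after [I], one for the error in law of the copy [W I]. *)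
have [I kI Ie] : exists2 I, (k <= I)%N & 5 * 2^-1 ^+ I <= ep.
  have : (fun i : nat => (2^-1 : R) ^+ i) @ \oo --> (0 : R).
    by apply: cvg_expr; rewrite ger0_norm ?invf_lt1 ?ltr1n.
  have ep5 : 0 < ep / 5 by lra.
  move=> /cvgrPdist_le/(_ (ep / 5) ep5)[I _ HI].
  exists (maxn I k); first exact: leq_maxr.
  have := HI (maxn I k) (leq_maxl _ _).
  by rewrite /= sub0r normrN ger0_norm ?exprn_ge0//; lra.
apply: le_trans Ie.
have km : (k <= m I.+1)%N by have := mi I.+1; lia.
have [jk|kj] := ltnP k j.
  have -> : V'' k @^-1` [set j] = set0.
    apply/seteqP; split=> w //= V''j; have [io _] := V''P k w.
    by have [i ki Wi] := io k; have := Wk i k w ki; rewrite Wi; lia.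
  have -> : V k @^-1` [set j] = set0.
    by apply/seteqP; split=> w //= Vj; have := Vk k w; lia.
  by rewrite !pr0 subrr normr0 mulr_ge0// exprn_ge0.
have mV'' : measurable (V'' k @^-1` [set j]) by exact: (code_sigma_measurable indB (GV k _)).
have mNU : measurable (\bigcup_j N (I + j)%N) by apply: bigcup_measurable.
(* Outside the union consecutive copies agree from [I] on, so the sequence is constant there and
   equals its upper limit. *)
have sub w : ~ (\bigcup_j N (I + j)%N) w -> V'' k w = W I k w.
  move=> nN; apply: is_limsup_unique (V''P k w) _; apply: (is_limsup_cst (I := I)).
  move=> i /subnKC <-; elim: (i - I)%N => [|n IH]; first by rewrite addn0.
  rewrite addnS -IH; apply/eqP; apply: contrapT => /negP nE; apply: nN.
  by exists n => //; rewrite /N/= eq_sym.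
have d1 : pr Q (V'' k @^-1` [set j]) <= pr Q (W I k @^-1` [set j]) + 4 * 2^-1 ^+ I.
  apply: (le_trans _ (lerD (lexx _) (prNU I kI))); apply: (le_trans _ (pr_leU _ _ _)) => //.
  apply: le_pr => //; first exact: measurableU.
  move=> w /= Vj; have [|nN] := pselect ((\bigcup_j N (I + j)%N) w); [by right|left].
  by rewrite /= -sub.
have d2 : pr Q (W I k @^-1` [set j]) <= pr Q (V'' k @^-1` [set j]) + 4 * 2^-1 ^+ I.
  apply: (le_trans _ (lerD (lexx _) (prNU I kI))); apply: (le_trans _ (pr_leU _ _ _)) => //.
  apply: le_pr => //; first exact: measurableU.
  move=> w /= Vj; have [|nN] := pselect ((\bigcup_j N (I + j)%N) w); [by right|left].
  by rewrite /= sub.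
pose g i : R := (i == j)%:R.
have gM i : (i <= k)%N -> 0 <= g i <= 1 by rewrite /g; case: eqP => _; rewrite !lexx ler01.
have := start_law gM km (xm I.+1); rewrite mul1r (bop_run indB lawB); last by rewrite subnKC.
rewrite !wsum_indic// !setIT.
rewrite -[pr Q (run _ _ _ _ @^-1` _)]/(pr Q (W I k @^-1` [set j])) => /le_trans/(_ (am I k _)).
have kmI : (k <= m I)%N by have := mi I; lia.
have : 2^-1 ^+ I / (m I).+1%:R <= 2^-1 ^+ I :> R.
  by rewrite ler_pdivrMr// ler_peMr ?exprn_ge0// ler1n.
move=> H /(_ kmI); rewrite !ler_norml => /andP[b1 b2].
move: (2^-1 ^+ I / (m I).+1%:R) H b1 b2 => t H b1 b2.
move: (2^-1 ^+ I) (pr Q (W I k @^-1` [set j])) d1 d2 H b1 b2 => s z d1 d2 H b1 b2.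
by apply/andP; split; lra.
Qed.

End law.
End LimitProcess.

(** * The chain of a Markov measure on the Pascal graph *)

Lemma pascal_process_lt d (T : measurableType d) (V : nat -> T -> nat) k w :
  pascal_process V -> (V k w < k.+1)%N.
Proof.
case=> _ /(_ w)[V0 VS]; elim: k => [|k IH]; first by rewrite V0.
by case: (VS k) => ->; lia.
Qed.

(* Equal to [0] at the vertices [b] of probability zero, since division by [0] gives [0]. *)
Definition step_prob d (R : realType) (T : measurableType d) (P : probability T R)
  (V : nat -> T -> nat) k b : R :=
  pr P (V k @^-1` [set b.-1] `&` V k.+1 @^-1` [set b]) / pr P (V k.+1 @^-1` [set b]).

Definition step_probs d (R : realType) (T : measurableType d) (P : probability T R)
  (V : nat -> T -> nat) k : seq R := mkseq (step_prob P V k) k.+2.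

Lemma step_probs01 d (R : realType) (T : measurableType d) (P : probability T R)
  (V : nat -> T -> nat) k p : pascal_process V -> p \in step_probs P V k -> 0 <= p <= 1.
Proof.
move=> [mV _] /mapP[b _ ->]; rewrite /step_prob divr_ge0 ?pr_ge0//=.
have [->|n0] := eqVneq (pr P (V k.+1 @^-1` [set b])) 0; first by rewrite invr0 mulr0.
rewrite ler_pdivrMr ?mul1r; last by rewrite lt_neqAle eq_sym n0 pr_ge0.
by apply: le_pr => [||w []] //; apply: measurableI.
Qed.

(** On [V k = b] the variable [V k] is frozen, so only the strict past still matters. *)
Lemma natfil_trace (T : Type) (V : nat -> T -> nat) k b C : natfil V k C ->
  exists2 C', natfil V k.+1 C' & C `&` V k @^-1` [set b] = C' `&` V k @^-1` [set b].
Proof.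
apply: (sigma_trace (@natfil_sigma _ V k.+1)) => _ [i [j [/= ki ->]]].
move: ki; rewrite leq_eqVlt => /predU1P[<-|ki]; last first.
  by exists (V i @^-1` [set j]) => //; exact: natfil_preimage.
have [->|bj] := eqVneq b j.
  exists setT; first exact: (sigma_setT (@natfil_sigma _ V k.+1)).
  by rewrite setTI setIid.
exists set0; first by case: (@natfil_sigma _ V k.+1).
by rewrite set0I; apply/seteqP; split=> w //= [Vj Vb]; move: bj; rewrite -Vb Vj eqxx.
Qed.

(** The trace on [V k.+1 = b] turns [C] into an event of the past of level [-(k + 2)], as
    [markov_process] requires. Since [V k] is [b] or [b - 1], one probability per vertex gives the
    whole kernel. *)
Lemma pascal_chain d (R : realType) (T : measurableType d) (P : probability T R)
  (V : nat -> T -> nat) : pascal_process V -> markov_process P V ->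
  chain P V (pascal_kern (fun k b => nth 0 (step_probs P V k) b)).
Proof.
move=> pV; have [mV Vpath] := pV; move=> MV k C a b FC.
have [C' FC' CC'] := natfil_trace b FC.
have mC' : measurable C' := natfil_measurable mV FC'.
set E := V k.+1 @^-1` [set b]; have mE : measurable E := mV _ _.
rewrite [E `&` C]setIC CC' -/E [C' `&` E]setIC.
set A := V k @^-1` [set a]; have mA : measurable A := mV _ _.
set D := V k @^-1` [set b.-1]; have mD : measurable D := mV _ _.
have mEC := measurableI _ _ mE mC'.
have mAE := measurableI _ _ mA mE.
have [E0|E0] := eqVneq (pr P E) 0.
  have EC0 : pr P (E `&` C') = 0.
    by apply/le_anti; rewrite pr_ge0 andbT -E0; apply: le_pr => // w [].
  rewrite EC0 mulr0; apply/le_anti; rewrite pr_ge0 andbT -EC0.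
  by apply: le_pr => [||w []] //; apply: measurableI.
have bk : (b < k.+2)%N.
  rewrite ltnNge; apply/negP => kb; move/eqP: E0; apply.
  rewrite (_ : E = set0) ?pr0//; apply/seteqP; split=> w //= Eb.
  by have := pascal_process_lt k.+1 w pV; rewrite /E/= in Eb; rewrite Eb; lia.
have MV' : pr P (A `&` (E `&` C')) * pr P E = pr P (A `&` E) * pr P (E `&` C').
  apply: EFin_inj; rewrite !EFinM -!prE//; last exact: measurableI.
  by rewrite setIA; exact: MV.
apply: (mulIf E0) => /=; rewrite MV' [RHS]mulrAC; congr (_ * _).
rewrite /pascal_kern nth_mkseq// /step_prob -/D -/E.
set p := pr P (D `&` E) / pr P E.
have DE : pr P (D `&` E) = p * pr P E by rewrite /p divfK.
have DE' : pr P (~` D `&` E) = (1 - p) * pr P E.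
  by rewrite mulrBl -DE mul1r (prIC P mD mE) addrC addKr.
rewrite mulrDl ![_ * _%:R * _]mulrAC -DE -DE'.
(* At the extreme vertices [b = 0] and [b = k.+1] the only possible position is [minn k b.-1], so
   there the first alternative always holds. *)
have VE w : E w -> V k w = if V k w == b.-1 then minn k b.-1 else minn k b.
  move=> Eb; have := pascal_process_lt k w pV.
  have [_ /(_ k)] := Vpath w; rewrite Eb; case: eqP; lia.
rewrite (prIC P mD mAE); congr (_ + _).
  have [ea|na] := eqVneq (minn k b.-1) a.
    rewrite mulr1; congr pr; apply/seteqP; split=> w; first by move=> [? []].
    by move=> [Dw Ew]; split=> //; split=> //; rewrite /A/= VE// Dw eqxx.
  rewrite mulr0 -[RHS](pr0 P); congr pr; apply/seteqP; split=> w //= [Dw [Aw Ew]].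
  by move: Aw; rewrite /A/= VE// Dw eqxx => /eqP; rewrite (negPf na).
have [ea|na] := eqVneq (minn k b) a.
  rewrite mulr1; congr pr; apply/seteqP; split=> w; first by move=> [? []].
  move=> [Dw Ew]; split=> //; split=> //; rewrite /A/= VE//.
  by case: eqP.
rewrite mulr0 -[RHS](pr0 P); congr pr; apply/seteqP; split=> w //= [Dw [Aw Ew]].
by move: Aw; rewrite /A/= VE//; case: eqP => // _ /eqP; rewrite (negPf na).
Qed.

(** * Law of a chain from its kernel and marginals *)

Fixpoint path_weight (R : realType) (kern : nat -> nat -> nat -> R)
  (a : nat -> nat) n b : R :=
  if n is n'.+1 then kern n' b (a n') * path_weight kern a n' (a n') else 1.

Lemma chain_path d (R : realType) (T : measurableType d) (P : probability T R)
  (V : nat -> T -> nat) kern a n b C : chain P V kern -> natfil V n C ->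
  pr P ([set w | forall k, (k < n)%N -> V k w = a k] `&` (V n @^-1` [set b] `&` C)) =
  path_weight kern a n b * pr P (V n @^-1` [set b] `&` C).
Proof.
move=> cV; elim: n b C => [|n IH] b C FC /=.
  rewrite mul1r; congr pr; apply/seteqP; split=> w; first by case.
  by split=> // k.
have FVC : natfil V n (V n.+1 @^-1` [set b] `&` C).
  apply: (sigma_setI (@natfil_sigma _ V n)); first exact: natfil_preimage.
  exact: natfil_le FC.
rewrite mulrAC -cV// mulrC -IH//; congr pr; apply/seteqP; split=> w /=.
  by move=> [Va Vb]; split; [move=> k kn; apply: Va; lia|split=> //; apply: Va].
move=> [Va [Vn Vb]]; split=> // k; rewrite ltnS leq_eqVlt => /predU1P[->//|].
exact: Va.
Qed.

(** There is no initial level, so the kernel alone does not fix the law. Conditioning a finite path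
    on [V n] reduces the claim to the marginal at [n]. *)
Lemma chain_same_law d d' (R : realType) (T : measurableType d) (T' : measurableType d')
  (P : probability T R) (Q : probability T' R) (V : nat -> T -> nat)
  (V' : nat -> T' -> nat) kern :
  (forall k j, measurable (V k @^-1` [set j])) ->
  (forall k j, measurable (V' k @^-1` [set j])) ->
  (forall k w, (V k w < k.+1)%N) -> (forall k w, (V' k w < k.+1)%N) ->
  chain P V kern -> chain Q V' kern ->
  (forall k j, pr Q (V' k @^-1` [set j]) = pr P (V k @^-1` [set j])) ->
  same_law P Q V V'.
Proof.
move=> mV mV' Vk Vk' cV cV' VV' n a.
have path_meas d0 (T0 : measurableType d0) (W : nat -> T0 -> nat) :
    (forall k j, measurable (W k @^-1` [set j])) ->
    measurable [set w | forall k, (k < n)%N -> W k w = a k].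
  move=> mW; have -> : [set w | forall k, (k < n)%N -> W k w = a k] =
    \bigcap_(k in `I_n) W k @^-1` [set a k] by [].
  by apply: (sigma_bigcap (@sigma_algebra_measurable _ T0)) => k _.
have mA := path_meas _ _ _ mV; have mA' := path_meas _ _ _ mV'.
rewrite !prE//; congr (_%:E).
rewrite -(pr_partition P (Vk n) (mV n) mA) -(pr_partition Q (Vk' n) (mV' n) mA').
apply: eq_bigr => b _.
have := chain_path a b cV (sigma_setT (@natfil_sigma _ V n)).
have := chain_path a b cV' (sigma_setT (@natfil_sigma _ V' n)).
by rewrite !setIT ![_ `&` (_ @^-1` _)]setIC VV' => -> ->.
Qed.

Lemma pr_partition_fin d (R : realType) (T : measurableType d) (P : probability T R)
  (X : finType) (Z : T -> X) C :
  (forall x, measurable (Z @^-1` [set x])) -> measurable C ->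
  \sum_x pr P (Z @^-1` [set x] `&` C) = pr P C.
Proof.
move=> mZ mC; pose r w : nat := enum_rank (Z w).
have rE (j : 'I_#|X|) : r @^-1` [set j : nat] = Z @^-1` [set enum_val j].
  apply/seteqP; split=> w; rewrite /r/=; last by move=> ->; rewrite enum_valK.
  by move=> /ord_inj <-; rewrite enum_rankK.
have rn w : (r w < #|X|)%N by apply: ltn_ord.
have mr j : measurable (r @^-1` [set j]).
  exact: (sigma_preimage (@sigma_algebra_measurable _ T) mZ [set x | enum_rank x = j :> nat]).
rewrite -(pr_partition P rn mr mC) (reindex (@enum_val X predT))/=.
  by apply: eq_bigr => j _; rewrite rE.
exact: onW_bij (enum_val_bij X).
Qed.

(** * Generation and immersion *)

Lemma sum_indic_sigma (R : realType) (T : Type) (F : set (set T)) (X : Type)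
  (l : seq X) (c : X -> R) (A : X -> set T) : sigma_algebra setT F ->
  (forall x, F (A x)) -> forall D : set R,
  F ((fun w => \sum_(x <- l) c x * \1_(A x) w) @^-1` D).
Proof.
move=> sF FA; elim: l => [|x l IH] D.
  have [D0|D0] := pselect (D 0).
    rewrite (_ : _ @^-1` _ = setT); first exact: sigma_setT.
    by apply/seteqP; split=> w //= _; rewrite big_nil.
  rewrite (_ : _ @^-1` _ = set0); first by case: sF.
  by apply/seteqP; split=> w //=; rewrite big_nil.
set g := fun w => \sum_(y <- l) c y * \1_(A y) w.
have -> : (fun w => \sum_(y <- x :: l) c y * \1_(A y) w) @^-1` D =
    (A x `&` g @^-1` [set r | D (c x + r)]) `|` (~` A x `&` g @^-1` D).
  apply/seteqP; split=> w /=; rewrite big_cons -/(g w) indicE.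
    have [Aw|Aw] := pselect (A x w).
      by rewrite mem_set// mulr1 => ?; left.
    by rewrite memNset// mulr0 add0r => ?; right.
  move=> [[Aw]|[Aw]]; first by rewrite mem_set// mulr1.
  by rewrite memNset// mulr0 add0r.
apply: (sigma_setU sF); apply: (sigma_setI sF) => //; try exact: IH.
exact: (sigma_setC sF).
Qed.

Lemma integral_sum_indic d (R : realType) (T : measurableType d)
  (P : probability T R) (X : Type) (l : seq X) (c : X -> R) (A : X -> set T)
  (C : set T) : (forall x, measurable (A x)) -> measurable C ->
  let f w := \sum_(x <- l) c x * \1_(A x) w in
  P.-integrable setT (EFin \o f) /\
  (\int[P]_(w in C) (f w)%:E = (\sum_(x <- l) c x * pr P (A x `&` C))%:E)%E.
Proof.
move=> mA mC; elim: l => [|x l [IH1 IH2]] f.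
  split.
    rewrite (_ : EFin \o f = cst 0%E); first exact: integrable0.
    by apply/funext => w; rewrite /f/= big_nil.
  under eq_integral do rewrite /f big_nil; rewrite big_nil.
  exact: integral0.
set g := fun w => \sum_(y <- l) c y * \1_(A y) w.
have iA : P.-integrable setT (EFin \o (fun w => c x * \1_(A x) w)).
  have := integrableZl measurableT (c x) (integrable_indic P (mA x)).
  by apply: eq_integrable => // w _.
pose h w := c x * \1_(A x) w.
have fE w : (f w)%:E = ((EFin \o h) w + (EFin \o g) w)%E.
  by rewrite /f big_cons -EFinD.
split.
  by apply: eq_integrable (integrableD measurableT iA IH1) => // w _; exact: esym (fE w).
under eq_integral do rewrite fE.
rewrite integralD//; [|exact: integrableS iA|exact: integrableS IH1].
rewrite IH2 big_cons EFinD; congr (_ + _)%E.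
under eq_integral do rewrite /= EFinM.
rewrite integralZl//; last first.
  by apply: (integrableS measurableT mC (@subsetT _ _)); exact: integrable_indic.
by rewrite integral_indic// EFinM; congr (_ * _)%E; apply/prE/measurableI.
Qed.

Section process.
Context d (R : realType) (T : measurableType d) (Q : probability T R).
Variable B : nat -> T -> seq bool.
Let U := digit_code R B.
Let G k := sigma_real [set j | (k <= j)%N] U.
Hypothesis indB : forall k A C, sigma_real [set k] U A -> G k.+1 C ->
  [/\ measurable A, measurable C & pr Q (A `&` C) = pr Q A * pr Q C].

Let sG k : sigma_algebra setT (G k).
Proof. exact: smallest_sigma_algebra. Qed.

Let mG k A : G k A -> measurable A.
Proof. exact: (code_sigma_measurable indB). Qed.

Let GB k j S : (k <= j)%N -> G k (B j @^-1` S).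
Proof. exact: code_sigma_digit. Qed.

(** The most remote digit list is first absorbed into the past event, then split off by [indB]. *)
Lemma digits_prod n (S : nat -> set (seq bool)) C : G n C ->
  pr Q (\big[setI/setT]_(j < n) (B j @^-1` S j) `&` C) =
  \prod_(j < n) pr Q (B j @^-1` S j) * pr Q C.
Proof.
elim: n C => [|n IH] C GC; first by rewrite !big_ord0 setTI mul1r.
have GC' : G n C by apply: code_sigma_le GC.
rewrite !big_ord_recr/= -setIA IH; last by apply: (sigma_setI (sG n)) => //; exact: GB.
have [_ _ ->] := indB (@code_preimage R T B [set n] n (S n) (erefl n)) GC.
by rewrite mulrA.
Qed.

Lemma digits_mutually_independent : mutually_independent Q U.
Proof.
have UE k D : U k @^-1` D = B k @^-1` [set s | D (pickle s)%:R] by [].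
split=> [k _ D mD|s D us mD].
  by rewrite setTI UE; apply: (mG (@GB 0%N k _ _)).
have [N sN] : exists N, forall i, i \in s -> (i < N)%N.
  by exists (\max_(i <- s) i).+1 => i si; rewrite ltnS; exact: leq_bigmax_seq.
(* The indices are sorted and then completed to an initial segment by trivial constraints, to match
   [digits_prod]. *)
have perm_s : perm_eq s [seq i <- index_iota 0 N | i \in s].
  apply: uniq_perm => //; first by rewrite filter_uniq// iota_uniq.
  move=> i; rewrite mem_filter mem_index_iota.
  by case: (boolP (i \in s)) => //= /sN.
pose S (j : nat) : set (seq bool) :=
  if j \in s then [set t | D j (pickle t)%:R] else setT.
have mS j : measurable (B j @^-1` S j) by apply: (mG (@GB 0%N j _ _)).
rewrite (perm_big _ perm_s) [RHS](perm_big _ perm_s)/= !big_filter.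
rewrite big_mkcond [RHS]big_mkcond !big_mkord.
have -> : \big[setI/setT]_(i < N) (if (i : nat) \in s then U i @^-1` D i else setT) =
    \big[setI/setT]_(i < N) (B i @^-1` S i) `&` setT.
  by rewrite setIT; apply: eq_bigr => i _; rewrite /S; case: ifP.
have mN : measurable (\big[setI/setT]_(i < N) (B i @^-1` S i) `&` setT).
  by rewrite setIT; apply: bigsetI_measurable.
rewrite prE// digits_prod ?prT ?mulr1; last exact: (sigma_setT (sG N)).
rewrite -prodEFin; apply: eq_bigr => i _; move: (mS i); rewrite /S.
by case: ifP => _ mSi; [exact: esym (prE Q mSi)|rewrite prT].
Qed.

Variable V : nat -> T -> nat.
Hypothesis VE : forall k w, V k w = phi k (V k.+1 w) (B k w).
Hypothesis GV : forall k S, G k (V k @^-1` S).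

Let Vk k w : (V k w <= k)%N.
Proof. by rewrite VE phi_le. Qed.

Lemma natfil_code k : natfil V k `<=` G k.
Proof.
apply: (smallest_sigma_sub (sG k)) => _ [i [j [/= ki ->]]].
exact: (code_sigma_le ki (@GV i [set j])).
Qed.

(** [V] is adapted to [G], so the joint past of [V] and [U] is contained in [G k.+1] and [indB]
    gives the independence. *)
Lemma digits_generating : generating_parameterization Q V U.
Proof.
split; first by case: digits_mutually_independent.
split.
  move=> k A C sA sC; have GC : G k.+1 C.
    apply: (smallest_sigma_sub (sG k.+1)) sC => D [|//]; exact: natfil_code.
  by have [mA mC H] := indB sA GC; apply: prM_indep.
split; last exact: natfil_code.
move=> k; set J := sigma_join _ _; have sJ : sigma_algebra setT J.
  exact: smallest_sigma_algebra.
apply: (smallest_sigma_sub sJ) => _ [i [j [/= ki ->]]].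
move: ki; rewrite leq_eqVlt => /predU1P[<-|ki]; last first.
  by apply: sub_sigma_algebra; left; exact: natfil_preimage.
have -> : V k @^-1` [set j] = \bigcup_v (V k.+1 @^-1` [set v] `&`
    B k @^-1` [set s | phi k v s = j]).
  apply/seteqP; split=> w /=; rewrite VE; first by exists (V k.+1 w).
  by case=> v _ [/= -> ->].
apply: (sigma_bigcup sJ) => v _; apply: (sigma_setI sJ); apply: sub_sigma_algebra.
  by left; exact: natfil_preimage.
by right; apply: code_preimage.
Qed.

(* The digits of levels [0 .. k - 1] used by paths of the graph form a variable with
   finitely many values, independent of [G k]; on each of its atoms the path
   [V 0, ..., V k] is a function of [V k]. *)
Lemma digits_immersed : immersed Q (natfil V) G.
Proof.
split=> [k|k A FA]; first exact: natfil_code.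
pose X := {ffun 'I_k -> {ffun 'I_k.+1 -> bool}}.
pose Z w : X := [ffun j : 'I_k => [ffun v : 'I_k.+1 => nth false (B j w) v]].
pose S (x : X) j : set (seq bool) := [set s | forall i : 'I_k, i = j :> nat ->
  forall v : 'I_k.+1, nth false s v = x i v].
have ZE x : Z @^-1` [set x] = \big[setI/setT]_(j < k) (B j @^-1` S x j).
  rewrite -(bigcap_mkord k (fun j => B j @^-1` S x j)).
  apply/seteqP; split=> w /=.
    by move=> <- j /= jk i ij v; rewrite !ffunE ij.
  move=> H; apply/ffunP => i; rewrite ffunE; apply/ffunP => v; rewrite ffunE.
  exact: (H i (ltn_ord i) i erefl v).
have mZ x : measurable (Z @^-1` [set x]).
  by rewrite ZE; apply: bigsetI_measurable => j _; apply: (mG (@GB 0%N j _ _)).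
have Zind x C : G k C -> pr Q (Z @^-1` [set x] `&` C) = pr Q (Z @^-1` [set x]) * pr Q C.
  move=> GC; rewrite ZE digits_prod// -[in RHS](setIT (\big[setI/setT]_(_ < k) _)).
  by rewrite digits_prod ?prT ?mulr1//; exact: (sigma_setT (sG k)).
have ZV x j : exists h : nat -> nat, forall w, Z w = x -> (j <= k)%N -> V j w = h (V k w).
  have [kj|jk] := ltnP k j; first by exists id => w _ jk; lia.
  rewrite -(subKn jk); elim: (k - j)%N (leq_subr j k) => [|n IH] nk.
    by exists id => w _ _; rewrite subn0.
  have [h hP] := IH (ltnW nk).
  have ik : (k - n.+1 < k)%N by lia.
  pose i := Ordinal ik.
  exists (fun v => minn i (h v - (if (h v < k.+1)%N then x i (inord (h v)) else false))).
  move=> w Zw _; have hw := hP w Zw isT.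
  have hk : (h (V k w) < k.+1)%N by rewrite -hw; have := Vk (k - n)%N w; lia.
  have iE : ((k - n.+1).+1 = k - n)%N by lia.
  by rewrite VE /phi iE hw hk -Zw !ffunE inordK.
have /boolp.choice[A' A'P] x : exists C, natfil V k C /\
    A `&` Z @^-1` [set x] = C `&` Z @^-1` [set x].
  suff [C ? ?] : exists2 C, natfil V k C & A `&` Z @^-1` [set x] = C `&` Z @^-1` [set x].
    by exists C.
  apply: (sigma_trace (@natfil_sigma _ V k)) FA => _ [i [j [_ ->]]].
  have [ki|ik] := leqP k i.
    by exists (V i @^-1` [set j]) => //; exact: natfil_preimage.
  have [h hP] := ZV x i; exists (V k @^-1` [set v | h v = j]).
    exact: natfil_preimage.
  by apply/seteqP; split=> w /= [Vw Zw]; split=> //; move: Vw; rewrite hP// ltnW.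
have FA' x : natfil V k (A' x) by case: (A'P x).
have GA' x : G k (A' x) := natfil_code (FA' x).
(* As [Z] is independent of [G k], averaging the indicators of [A' x] over the law of [Z] gives the
   conditional probability of [A]. *)
pose f w := \sum_(x <- index_enum X) pr Q (Z @^-1` [set x]) * \1_(A' x) w.
exists f; split.
  by move=> D _; apply: (sum_indic_sigma _ _ (@natfil_sigma _ V k)).
have mA' x : measurable (A' x) := mG (GA' x).
split; first by have [] := integral_sum_indic Q (index_enum X) (fun x => pr Q (Z @^-1` [set x])) mA' measurableT.
move=> C GC; have mC := mG GC.
have [_ ->] := integral_sum_indic Q (index_enum X) (fun x => pr Q (Z @^-1` [set x])) mA' mC.
have mA : measurable A by apply: (mG (natfil_code FA)).
have mAC := measurableI _ _ mA mC.
rewrite prE// -(pr_partition_fin Q mZ mAC); congr (_%:E).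
apply: eq_bigr => x _; rewrite -Zind; last exact: (sigma_setI (sG k)).
congr pr; have [_ AE] := A'P x.
by rewrite !setIA ![Z @^-1` _ `&` _]setIC AE.
Qed.

End process.

(** * Generating parameterization and standardness *)

Theorem theorem6p2 (R : realType) (d : measure_display) (T : measurableType d)
  (P : probability T R) (V : nat -> T -> nat) :
  pascal_process V -> tail_trivial P V -> markov_process P V ->
  admits_generating_parameterization P V /\ standard_filtration P V.
Proof.
move=> pV tV MV; have [mV _] := pV.
pose ps := step_probs P V.
have ps01 k p : p \in ps k -> 0 <= p <= 1 by apply: step_probs01.
pose q k b := nth 0 (ps k) b.
have cV : chain P V (pascal_kern q) := pascal_chain pV MV.
have Vk k w : (V k w < k.+1)%N by apply: pascal_process_lt.
pose Q : probability (measurableTypeR R) R := @unif R.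
pose B := digit_seq ps.
have indB := digit_seq_indep ps01.
have lawB := digit_seq_marginal ps01.
have [V' [VE GV VV']] := exists_limit_process mV Vk cV tV indB lawB.
have mV' k j : measurable (V' k @^-1` [set j]) := code_sigma_measurable indB (GV k _).
have Vk' k w : (V' k w < k.+1)%N by rewrite VE ltnS phi_le.
(* [V' k.+1] and its past lie in [G k.+1], hence are independent of the digits that drive the next
   transition. *)
have cV' : chain Q V' (pascal_kern q).
  move=> k C a b FC.
  have GC := natfil_code GV FC.
  have <- := phi_step indB lawB a (GV k.+1 [set b]) GC.
  by congr pr; apply/seteqP; split=> w /=; rewrite (VE k w).
have law := chain_same_law mV mV' Vk Vk' cV cV' VV'.
split.
  exists _, (measurableTypeR R), Q, V', (digit_code R B); split=> //; split=> //.
  exact: digits_generating.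
exists _, (measurableTypeR R), Q, V', (digit_code R B); split=> //; split=> //; split.
  exact: digits_mutually_independent.
exact: digits_immersed.
Qed.
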